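(* Consider system (5) in the standing setup with fixed $\sigma$ and weights. If $\mathcal G_{\sigma(t)}$ is uniformly jointly L-connected (UJLC), then system (5) is SiISS with respect to $\mathcal L(y(t))$.
   Context: Standing setup. Fix integers $n\ge 2$, $k\ge 1$, $d\ge 1$. The follower set is $\mathcal V_F=\{1,\dots,n\}$ and the leader set is $\mathcal V_L=\{\hat 1,\dots,\hat k\}$ (disjoint from $\mathcal V_F$); $\mathcal V=\mathcal V_F\cup\mathcal V_L$. The interaction topology is a time-varying digraph $\mathcal G_{\sigma(t)}=(\mathcal V,\mathcal E_{\sigma(t)})$, where $\sigma:[0,\infty)\to\mathcal P$ is a piecewise constant switching signal taking values in a finite set $\mathcal P$ of digraphs on $\mathcal V$; no arc of any of these digraphs enters a leader. An arc $(j,i)$ means that $i$ receives information from $j$. Dwell-time assumption: any two consecutive switching instants of $\sigma$ are separated by at least $\tau_D>0$. For $i\in\mathcal V_F$, $N_i(\sigma(t))=\{j\in\mathcal V_F:(j,i)\in\mathcal E_{\sigma(t)}\}$ and $L_i(\sigma(t))=\{j\in\mathcal V_L:(j,i)\in\mathcal E_{\sigma(t)}\}$. $\mathcal G^F_{\sigma(t)}$ denotes the subgraph of $\mathcal G_{\sigma(t)}$ induced on $\mathcal V_F$. For $0\le t_1<t_2\le\infty$ the joint graph is $\mathcal G([t_1,t_2))=(\mathcal V,\bigcup_{t\in[t_1,t_2)}\mathcal E_{\sigma(t)})$, and $\mathcal G^F([t_1,t_2))$ is its subgraph induced on $\mathcal V_F$. System (5): $\dot y_i=u_i(y,t)$ for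 $i=1,\dots,k$, and $\dot x_i=\sum_{j\in N_i(\sigma(t))}a_{ij}(x,y,t)(x_j-x_i)+\sum_{j\in L_i(\sigma(t))}b_{ij}(x,y,t)(y_j-x_i)+w_i(t)$ for $i=1,\dots,n$, where $x_i,y_j\in\mathbb R^d$, $x=(x_1,\dots,x_n)$, $y=(y_1,\dots,y_k)$; each $u_i(y,t)$ is continuous in $y$ and piecewise continuous in $t$; each $w_i$ is continuous; the weights $a_{ij},b_{ij}$ are continuous and satisfy $a_*\le a_{ij}(x,y,t)\le a^*$, $b_{ij}(x,y,t)\ge b_*$ for all $x,y,t$, with constants $0<a_*\le a^*$, $b_*>0$. Initial time is $0$, $x^0=x(0)$, $y^0=y(0)$. Along a trajectory, $z(t)=(u_1(y(t),t),\dots,u_k(y(t),t),w_1(t),\dots,w_n(t))\in\mathbb R^{(n+k)d}$ and $\|z\|_\infty=\sup_{t\ge0}|z(t)|$. Set notation: $|\cdot|$ is the Euclidean norm; for a closed convex $K\subset\mathbb R^d$, $|v|_K=\inf_{p\in K}|v-p|$; $\mathcal L(y(t))=\mathrm{co}\{y_1(t),\dots,y_k(t)\}$ (convex hull); $|x(t)|_{\mathcal L(y(t))}=\max_{i\in\mathcal V_F}|x_i(t)|_{\mathcal L(y(t))}$. Connectivity: a digraph on $\mathcal V$ is L-connected if for every $i\in\mathcal V_F$ there is a directed path from some leader $j\in\mathcal V_L$ to $i$. $\mathcal G_{\sigma(t)}$ is jointly L-connected (JLC) if $\mathcal G([t,\infty))$ is L-connected for every $t\ge0$; it is uniformly jointly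 L-connected (UJLC) if there is $T>0$ such that $\mathcal G([t,t+T))$ is L-connected for every $t\ge0$. SiISS: system (5) is (globally, generalized) set integral-input-to-state stable with respect to $\mathcal L(y(t))$ if there exist a class-$\mathcal{KL}$ function $\beta$ and a class-$\mathcal K$ function $\gamma$ such that for all admissible $u_i,w_i$ and all initial conditions $x^0\in\mathbb R^{nd}$, $y^0\in\mathbb R^{kd}$: $|x(t)|_{\mathcal L(y(t))}\le\beta(|x^0|_{\mathcal L(y^0)},t)+\int_0^t\gamma(|z(s)|)\,ds$ for all $t\ge0$. *)

(* Defs.v *)
From Stdlib Require Import Reals Lra Lia List ClassicalEpsilon.
Open Scope R_scope.

Fixpoint sumR (m : nat) (f : nat -> R) : R :=
  match m with O => 0 | S p => sumR p f + f p end.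
Fixpoint maxR (m : nat) (f : nat -> R) : R :=
  match m with O => 0 | S p => Rmax (maxR p f) (f p) end.

(* A vector of R^d is a function nat -> R (components 0..d-1).
   A stack of m vectors in R^d is nat -> nat -> R (agent, component). *)
Definition vec := nat -> R.
Definition stack := nat -> nat -> R.

Definition normd (d : nat) (v : vec) : R := sqrt (sumR d (fun c => (v c) ^ 2)).

Definition in_hull (k d : nat) (Y : stack) (p : vec) : Prop :=
  exists lam : nat -> R,
    (forall j, (j < k)%nat -> 0 <= lam j) /\ sumR k lam = 1 /\
    (forall c, (c < d)%nat -> p c = sumR k (fun j => lam j * Y j c)).

Definition is_inf (E : R -> Prop) (m : R) : Prop :=
  (forall r, E r -> m <= r) /\ (forall b, (forall r, E r -> b <= r) -> b <= m).
Definition Inf (E : R -> Prop) : R := epsilon (inhabits 0) (is_inf E).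

Definition hull_dist (k d : nat) (Y : stack) (v : vec) : R :=
  Inf (fun r => exists p, in_hull k d Y p /\ r = normd d (fun c => v c - p c)).

Definition state_dist (n k d : nat) (X Y : stack) : R :=
  maxR n (fun i => hull_dist k d Y (X i)).

(* followers VF 0..n-1 (paper: 1..n), leaders VL 0..k-1 (paper: 1^..k^) *)
Inductive vertex := VF (i : nat) | VL (j : nat).
Definition valid (n k : nat) (v : vertex) : Prop :=
  match v with VF i => (i < n)%nat | VL j => (j < k)%nat end.
(* E u v = true  means arc (u,v): v receives information from u *)
Definition digraph := vertex -> vertex -> bool.
Definition is_digraph_on (n k : nat) (E : digraph) : Prop :=
  forall u v, E u v = true -> valid n k u /\ valid n k v.
Definition no_arc_into_leader (E : digraph) : Prop :=
  forall u j, E u (VL j) = false.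

Inductive dpath (E : vertex -> vertex -> Prop) : vertex -> vertex -> Prop :=
| dp_arc u v : E u v -> dpath E u v
| dp_step u w v : dpath E u w -> E w v -> dpath E u v.

Definition L_connected (n k : nat) (E : vertex -> vertex -> Prop) : Prop :=
  forall i, (i < n)%nat -> exists j, (j < k)%nat /\ dpath E (VL j) (VF i).

Definition joint_arcs (sigma : R -> digraph) (t1 t2 : R) : vertex -> vertex -> Prop :=
  fun u v => exists s, t1 <= s < t2 /\ sigma s u v = true.

Definition UJLC (n k : nat) (sigma : R -> digraph) : Prop :=
  exists T, 0 < T /\ forall t, 0 <= t -> L_connected n k (joint_arcs sigma t (t + T)).

Definition admissible_switching (n k : nat) (sigma : R -> digraph) : Prop :=
  (exists P : list digraph,
      (forall G, In G P -> is_digraph_on n k G /\ no_arc_into_leader G) /\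
      (forall t, 0 <= t -> exists G, In G P /\ forall u v, sigma t u v = G u v)) /\
  (exists (tauD : R) (sw : nat -> R),
      0 < tauD /\ sw O = 0 /\
      (forall m, sw (S m) - sw m >= tauD) /\
      (forall m t, sw m <= t < sw (S m) -> forall u v, sigma t u v = sigma (sw m) u v)).

Definition cont_on_nonneg (g : R -> R) : Prop :=
  forall t, 0 <= t -> forall eps, 0 < eps -> exists delta, 0 < delta /\
    forall s, 0 <= s -> Rabs (s - t) < delta -> Rabs (g s - g t) < eps.

Definition partition_seq (p : nat -> R) : Prop :=
  p O = 0 /\ (forall m, p m < p (S m)) /\ (forall M, exists m, M < p m).

Definition piecewise_cont (g : R -> R) : Prop :=
  exists p, partition_seq p /\
    forall m,
      (forall t, p m < t < p (S m) -> continuity_pt g t) /\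
      (exists l, limit1_in g (fun s => p m < s) l (p m)) /\
      (exists l, limit1_in g (fun s => s < p (S m)) l (p (S m))).

Definition cont_xyt (n k d : nat) (f : stack -> stack -> R -> R) : Prop :=
  forall X Y t, 0 <= t -> forall eps, 0 < eps -> exists delta, 0 < delta /\
    forall X' Y' t', 0 <= t' ->
      (forall i c, (i < n)%nat -> (c < d)%nat -> Rabs (X' i c - X i c) < delta) ->
      (forall j c, (j < k)%nat -> (c < d)%nat -> Rabs (Y' j c - Y j c) < delta) ->
      Rabs (t' - t) < delta ->
      Rabs (f X' Y' t' - f X Y t) < eps.

Definition cont_y (k d : nat) (f : stack -> R) : Prop :=
  forall Y eps, 0 < eps -> exists delta, 0 < delta /\
    forall Y', (forall j c, (j < k)%nat -> (c < d)%nat -> Rabs (Y' j c - Y j c) < delta) ->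
      Rabs (f Y' - f Y) < eps.

Definition classK (g : R -> R) : Prop :=
  g 0 = 0 /\ cont_on_nonneg g /\ (forall r s, 0 <= r -> r < s -> g r < g s).

Definition classKL (beta : R -> R -> R) : Prop :=
  (forall r s, 0 <= r -> 0 <= s -> forall eps, 0 < eps -> exists delta, 0 < delta /\
     forall r' s', 0 <= r' -> 0 <= s' -> Rabs (r' - r) < delta -> Rabs (s' - s) < delta ->
       Rabs (beta r' s' - beta r s) < eps) /\
  (forall s, 0 <= s -> classK (fun r => beta r s)) /\
  (forall r, 0 <= r ->
     (forall s1 s2, 0 <= s1 -> s1 <= s2 -> beta r s2 <= beta r s1) /\
     (forall eps, 0 < eps -> exists S, forall s, S <= s -> Rabs (beta r s) < eps)).

(* u j Y t c : c-th component of u_j(y,t);  w i t c : c-th component of w_i(t);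
   a i j X Y t = a_ij(x,y,t);  b i j X Y t = b_ij(x,y,t). *)
Definition rhs_x (n k : nat) (sigma : R -> digraph)
  (a b : nat -> nat -> stack -> stack -> R -> R) (w : nat -> R -> vec)
  (X Y : stack) (t : R) (i c : nat) : R :=
  sumR n (fun j => if sigma t (VF j) (VF i) then a i j X Y t * (X j c - X i c) else 0)
  + sumR k (fun j => if sigma t (VL j) (VF i) then b i j X Y t * (Y j c - X i c) else 0)
  + w i t c.

Definition is_solution (n k d : nat) (sigma : R -> digraph)
  (a b : nat -> nat -> stack -> stack -> R -> R)
  (u : nat -> stack -> R -> vec) (w : nat -> R -> vec)
  (x y : R -> stack) : Prop :=
  (forall i c, (i < n)%nat -> (c < d)%nat -> cont_on_nonneg (fun t => x t i c)) /\
  (forall j c, (j < k)%nat -> (c < d)%nat -> cont_on_nonneg (fun t => y t j c)) /\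
  exists e, partition_seq e /\
    forall m t, e m < t < e (S m) ->
      (forall i c, (i < n)%nat -> (c < d)%nat ->
         derivable_pt_lim (fun s => x s i c) t (rhs_x n k sigma a b w (x t) (y t) t i c)) /\
      (forall j c, (j < k)%nat -> (c < d)%nat ->
         derivable_pt_lim (fun s => y s j c) t (u j (y t) t c)).

Definition z_norm (n k d : nat) (u : nat -> stack -> R -> vec) (w : nat -> R -> vec)
  (y : R -> stack) (t : R) : R :=
  sqrt (sumR k (fun j => sumR d (fun c => (u j (y t) t c) ^ 2))
        + sumR n (fun i => sumR d (fun c => (w i t c) ^ 2))).

(* Main.v *)
Require Import Defs.
From Stdlib Require Import Reals Lra Lia List Classical ClassicalEpsilon.
From Coquelicot Require Import Coquelicot.
Open Scope R_scope.

(** The distance of [v] to the leaders' hull is at most [B >= 0] iff for every unit vector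
    [eta] some leader [y_j] satisfies [eta . v <= eta . y_j + B].  For a fixed [eta] the
    projected positions obey a scalar cooperative system; subtracting the largest initial
    leader projection and a primitive of a step majorant of [|z|] (which is only Riemann
    integrable, so its own primitive need not be differentiable) gives functions [h_i] with
    [h_i' <= sum_j a_ij (h_j - h_i) - B_i h_i] off a finite set of times, where [B_i] is the
    sum of the active leader weights.  If [h <= H] initially, then [h <= H] forever.
    On each window of length [T + 2 delta], joint connectivity and the dwell time provide an
    arc, active during [delta], from a leader or a follower with a gap below [H] to a
    follower without one; it creates a gap proportional to [H] that later decays at most
    exponentially.  After [n] windows every follower has a gap, so the largest [h_i] is
    contracted by a fixed factor that does not depend on [eta] or on the solution. *)

(** * Cooperative differential inequalities *)

Lemma sumR_ext m f g : (forall i, (i < m)%nat -> f i = g i) -> sumR m f = sumR m g.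
Proof.
  induction m as [|m IH]; intros H; simpl; [reflexivity|].
  rewrite IH, (H m) by (auto; intros; apply H; lia); reflexivity.
Qed.

Lemma sumR_le m f g : (forall i, (i < m)%nat -> f i <= g i) -> sumR m f <= sumR m g.
Proof.
  induction m as [|m IH]; intros H; simpl; [lra|].
  apply Rplus_le_compat; [apply IH; intros; apply H; lia | apply H; lia].
Qed.

Lemma sumR_plus m f g : sumR m (fun i => f i + g i) = sumR m f + sumR m g.
Proof. induction m as [|m IH]; simpl; [lra | rewrite IH; lra]. Qed.

Lemma sumR_scal m c f : sumR m (fun i => c * f i) = c * sumR m f.
Proof. induction m as [|m IH]; simpl; [lra | rewrite IH; lra]. Qed.

Lemma sumR_const m c : sumR m (fun _ => c) = INR m * c.
Proof. induction m as [|m IH]; simpl sumR; [simpl; lra | rewrite IH, S_INR; lra]. Qed.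

Lemma sumR_nonneg m f : (forall i, (i < m)%nat -> 0 <= f i) -> 0 <= sumR m f.
Proof.
  intros H. rewrite <- (Rmult_0_r (INR m)), <- (sumR_const m 0). now apply sumR_le.
Qed.

Lemma sumR_term_le m f i :
  (forall j, (j < m)%nat -> 0 <= f j) -> (i < m)%nat -> f i <= sumR m f.
Proof.
  induction m as [|m IH]; intros H Hi; [lia|]. simpl.
  destruct (Nat.eq_dec i m) as [->|Hne].
  - assert (0 <= sumR m f) by (apply sumR_nonneg; intros; apply H; lia). lra.
  - assert (0 <= f m) by (apply H; lia).
    assert (f i <= sumR m f) by (apply IH; [intros; apply H; lia | lia]). lra.
Qed.

Lemma sumR_swap m p (f : nat -> nat -> R) :
  sumR m (fun i => sumR p (fun j => f i j)) = sumR p (fun j => sumR m (fun i => f i j)).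
Proof.
  induction m as [|m IH]; simpl.
  - rewrite sumR_const; lra.
  - rewrite IH, sumR_plus; reflexivity.
Qed.

Lemma sumR_derivable m (f df : nat -> R -> R) t :
  (forall i, (i < m)%nat -> derivable_pt_lim (f i) t (df i t)) ->
  derivable_pt_lim (fun s => sumR m (fun i => f i s)) t (sumR m (fun i => df i t)).
Proof.
  induction m as [|m IH]; intros H; simpl.
  - apply derivable_pt_lim_const.
  - apply (derivable_pt_lim_plus (fun s => sumR m (fun i => f i s)) (f m));
      [apply IH; intros; apply H; lia | apply H; lia].
Qed.

Lemma sumR_continuity m (f : nat -> R -> R) :
  (forall i, (i < m)%nat -> continuity (f i)) ->
  continuity (fun s => sumR m (fun i => f i s)).
Proof.
  induction m as [|m IH]; intros H; simpl.
  - apply continuity_const; intros ? ?; reflexivity.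
  - apply (continuity_plus (fun s => sumR m (fun i => f i s)) (f m));
      [apply IH; intros; apply H; lia | apply H; lia].
Qed.

(** Induction on [l]: the interval is cut at the head of the list, and on a piece free of
    exceptional times the mean value theorem applies. Continuity glues the pieces together. *)
Lemma nonincreasing_off_finite l : forall f df p q,
  p <= q -> continuity f ->
  (forall t, p < t < q -> ~ In t l -> derivable_pt_lim f t (df t) /\ df t <= 0) ->
  f q <= f p.
Proof.
  induction l as [|a l IH]; intros f df p q Hpq Hc Hd.
  (* The mean value point may be an endpoint, where nothing is known about [df]; truncating by
     [Rmin 0] fixes the sign there too. *)
  - destruct (MVT_gen f p q (fun t => Rmin 0 (df t))) as [c [_ Heq]].
    + intros t Ht. rewrite Rmin_left, Rmax_right in Ht by lra.
      destruct (Hd t Ht (fun H => H)) as [Hf Hf0].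
      rewrite Rmin_right by lra. now apply is_derive_Reals.
    + intros t _; apply Hc.
    + assert (Hm := Rmin_l 0 (df c)). nra.
  - destruct (Rlt_dec p a) as [Hpa|Hpa]; [destruct (Rlt_dec a q) as [Haq|Haq]|].
    + apply Rle_trans with (f a); apply (IH f df); try lra; auto;
        intros t Ht Hl; (apply Hd; [lra|intros [-> |H]; [lra|auto]]).
    + apply (IH f df); auto; intros t Ht Hl; apply Hd; [lra|intros [-> |H]; [lra|auto]].
    + apply (IH f df); auto; intros t Ht Hl; apply Hd; [lra|intros [-> |H]; [lra|auto]].
Qed.

(** A C^1 function that vanishes exactly on the nonpositive reals: it turns an inequality [f <= c]
    into monotonicity of a differentiable function. *)
Definition pos_sq (r : R) : R := (Rmax 0 r) ^ 2.

Lemma pos_sq_derivable r : derivable_pt_lim pos_sq r (2 * Rmax 0 r).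
Proof.
  intros eps Heps. exists (mkposreal eps Heps). intros h Hh0 Hh. simpl in Hh.
  apply Rle_lt_trans with (2 := Hh).
  assert (Hb : Rabs (pos_sq (r + h) - pos_sq r - 2 * Rmax 0 r * h) <= h * h).
  { unfold pos_sq. apply Rabs_le.
    destruct (Rle_dec 0 r); destruct (Rle_dec 0 (r + h));
      rewrite ?(Rmax_right 0 r), ?(Rmax_right 0 (r + h)),
              ?(Rmax_left 0 r), ?(Rmax_left 0 (r + h)) by lra; nra. }
  replace ((pos_sq (r + h) - pos_sq r) / h - 2 * Rmax 0 r)
    with ((pos_sq (r + h) - pos_sq r - 2 * Rmax 0 r * h) * / h) by (field; auto).
  rewrite Rabs_mult, Rabs_inv.
  assert (0 < Rabs h) by (apply Rabs_pos_lt; auto).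
  apply Rmult_le_reg_r with (Rabs h); auto.
  rewrite Rmult_assoc, Rinv_l, Rmult_1_r by lra.
  rewrite <- Rabs_mult. apply Rle_trans with (1 := Hb). apply Rle_abs.
Qed.

Lemma pos_sq_continuity : continuity pos_sq.
Proof.
  intros r. apply derivable_continuous_pt. exists (2 * Rmax 0 r). apply pos_sq_derivable.
Qed.

Lemma pos_sq_nonneg r : 0 <= pos_sq r.
Proof. apply pow2_ge_0. Qed.

Lemma pos_sq_nonpos_arg r : pos_sq r <= 0 -> r <= 0.
Proof.
  unfold pos_sq; intros H. destruct (Rle_dec r 0); [auto|].
  rewrite Rmax_right in H by lra. nra.
Qed.

Lemma pos_sq_of_nonpos r : r <= 0 -> pos_sq r = 0.
Proof. unfold pos_sq; intros H. rewrite Rmax_left by lra. ring. Qed.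

(** [pos_sq (f - c)] is nonincreasing: its derivative vanishes where [f <= c], so the derivatives
    need comparing only where [f] lies above the barrier [c]. *)
Lemma scalar_comparison l f df c dc p q :
  p <= q -> continuity f -> continuity c ->
  (forall t, p < t < q -> ~ In t l ->
     derivable_pt_lim f t (df t) /\ derivable_pt_lim c t (dc t) /\
     (c t < f t -> df t <= dc t)) ->
  f p <= c p -> f q <= c q.
Proof.
  intros Hpq Hf Hc Hd H0.
  assert (H : pos_sq (f q - c q) <= pos_sq (f p - c p)).
  { apply (nonincreasing_off_finite l (fun t => pos_sq (f t - c t))
             (fun t => 2 * Rmax 0 (f t - c t) * (df t - dc t))); auto.
    - apply (continuity_comp (fun t => f t - c t) pos_sq);
        [now apply continuity_minus | apply pos_sq_continuity].
    - intros t Ht Hl. destruct (Hd t Ht Hl) as (Hdf & Hdc & Hle). split.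
      + apply (derivable_pt_lim_comp (fun t => f t - c t) pos_sq);
          [now apply derivable_pt_lim_minus | apply pos_sq_derivable].
      + destruct (Rle_dec (f t - c t) 0).
        * rewrite Rmax_left by lra. lra.
        * rewrite Rmax_right by lra. assert (df t <= dc t) by (apply Hle; lra). nra. }
  rewrite (pos_sq_of_nonpos (f p - c p)) in H by lra.
  apply pos_sq_nonpos_arg in H. lra.
Qed.

Lemma exp_le_1 x : x <= 0 -> exp x <= 1.
Proof.
  intros [H| ->]; [|rewrite exp_0; lra]. rewrite <- exp_0. left; now apply exp_increasing.
Qed.

(** The follower couplings [al] are bounded by [a_hi], whereas [B] is only nonnegative, because
    leader weights have no upper bound. [l] lists the times at which derivatives may fail to
    exist. *)
Definition cooperative (n : nat) (a_hi : R) (l : list R) (p q : R)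
  (al : nat -> nat -> R -> R) (B h dh : nat -> R -> R) : Prop :=
  (forall i, (i < n)%nat -> continuity (h i)) /\
  forall t, p < t < q -> ~ In t l -> forall i, (i < n)%nat ->
    derivable_pt_lim (h i) t (dh i t) /\
    dh i t <= sumR n (fun j => al i j t * (h j t - h i t)) - B i t * h i t /\
    (forall j, (j < n)%nat -> 0 <= al i j t <= a_hi) /\ 0 <= B i t.

Lemma cooperative_sub n a_hi l p q p' q' al B h dh :
  p <= p' -> q' <= q ->
  cooperative n a_hi l p q al B h dh -> cooperative n a_hi l p' q' al B h dh.
Proof.
  intros Hp Hq [Hc H]. split; [exact Hc|]. intros t Ht. apply H. lra.
Qed.

(** The sum [S] of the [pos_sq (h_i - H)] satisfies [S' <= C S] and starts at 0, so it stays 0 by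
    Gronwall. The term [- B_i h_i] only helps, since [h_i > H >= 0] wherever it counts. *)
Lemma max_principle n a_hi l p q al B h dh H :
  p <= q -> 0 <= a_hi -> 0 <= H -> cooperative n a_hi l p q al B h dh ->
  (forall i, (i < n)%nat -> h i p <= H) -> forall i, (i < n)%nat -> h i q <= H.
Proof.
  intros Hpq Ha HH [Hcont Hco] H0 i Hi.
  set (S := fun t => sumR n (fun i => pos_sq (h i t - H))).
  set (dS := fun t => sumR n (fun i => 2 * Rmax 0 (h i t - H) * (dh i t - 0))).
  set (C := 2 * (INR n * a_hi)).
  assert (Hder : forall t, p < t < q -> ~ In t l -> derivable_pt_lim S t (dS t)).
  { intros t Ht Hl. apply (sumR_derivable n (fun i t => pos_sq (h i t - H))
      (fun i t => 2 * Rmax 0 (h i t - H) * (dh i t - 0))).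
    intros j Hj. apply (derivable_pt_lim_comp (fun t => h j t - H) pos_sq).
    - apply (derivable_pt_lim_minus (h j) (fun _ => H)).
      + now apply Hco.
      + apply derivable_pt_lim_const.
    - apply pos_sq_derivable. }
  assert (Hle : forall t, p < t < q -> ~ In t l -> dS t <= C * S t).
  { intros t Ht Hl. unfold dS, S, C.
    (* Each coupling contributes at most [2 a_hi u v <= a_hi (u^2 + v^2)], with [u], [v] the
       positive parts; the double sum is then [2 n a_hi S]. *)
    apply Rle_trans with (sumR n (fun i => sumR n (fun j =>
      a_hi * pos_sq (h i t - H) + a_hi * pos_sq (h j t - H)))).
    - apply sumR_le. intros j Hj. destruct (Hco t Ht Hl j Hj) as (_ & Hd & Hal & HB).
      assert (Hm := Rmax_l 0 (h j t - H)).
      apply Rle_trans with (2 * Rmax 0 (h j t - H) *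
        sumR n (fun m => al j m t * (h m t - h j t))).
      { assert (0 <= Rmax 0 (h j t - H) * (B j t * h j t)).
        { destruct (Rle_dec (h j t) H).
          - rewrite Rmax_left by lra. lra.
          - apply Rmult_le_pos; auto. apply Rmult_le_pos; lra. }
        nra. }
      rewrite <- sumR_scal. apply sumR_le. intros m Hmn. specialize (Hal m Hmn).
      unfold pos_sq. set (u := Rmax 0 (h j t - H)) in *. set (v := Rmax 0 (h m t - H)).
      assert (Hv0 : 0 <= v) by apply Rmax_l.
      assert (Hv : h m t - H <= v) by apply Rmax_r.
      assert (Huv : u * (h m t - h j t) <= u * v).
      { unfold u. destruct (Rle_dec (h j t - H) 0).
        - rewrite Rmax_left by lra. lra.
        - rewrite Rmax_right by lra. apply Rmult_le_compat_l; lra. }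
      assert (0 <= u * v) by (apply Rmult_le_pos; lra).
      apply Rle_trans with (2 * (al j m t * (u * v))).
      { replace (2 * u * (al j m t * (h m t - h j t)))
          with (2 * (al j m t * (u * (h m t - h j t)))) by ring.
        apply Rmult_le_compat_l; [lra|]. apply Rmult_le_compat_l; lra. }
      assert (al j m t * (u * v) <= a_hi * (u * v)) by (apply Rmult_le_compat_r; lra).
      assert (0 <= a_hi * (u - v) ^ 2) by (apply Rmult_le_pos; [lra | apply pow2_ge_0]).
      nra.
    - right.
      rewrite (sumR_ext n _ (fun i => INR n * (a_hi * pos_sq (h i t - H)) +
        a_hi * sumR n (fun j => pos_sq (h j t - H)))).
      2:{ intros j Hj. rewrite sumR_plus, sumR_const, sumR_scal. reflexivity. }
      rewrite sumR_plus, sumR_const, sumR_scal, sumR_scal. ring. }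
  assert (HSq : S q * exp (- C * q) <= S p * exp (- C * p)).
  { apply (nonincreasing_off_finite l (fun t => S t * exp (- C * t))
      (fun t => dS t * exp (- C * t) + S t * (exp (- C * t) * - C))); auto.
    - apply (continuity_mult S (fun t => exp (- C * t))).
      + apply (sumR_continuity n (fun i t => pos_sq (h i t - H))). intros j Hj.
        apply (continuity_comp (fun t => h j t - H) pos_sq); [|apply pos_sq_continuity].
        apply continuity_minus; [now apply Hcont|].
        apply continuity_const; intros ? ?; reflexivity.
      + intros t. apply derivable_continuous_pt. reg.
    - intros t Ht Hl. split.
      + apply (derivable_pt_lim_mult S (fun t => exp (- C * t))); [auto|].
        apply is_derive_Reals. auto_derive; [exact I | ring].
      + specialize (Hle t Ht Hl). assert (He := exp_pos (- C * t)). nra. }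
  assert (HSp : S p = 0).
  { unfold S. rewrite (sumR_ext n _ (fun _ => 0)), sumR_const; [ring|].
    intros j Hj. apply pos_sq_of_nonpos. specialize (H0 j Hj). lra. }
  rewrite HSp in HSq.
  assert (He := exp_pos (- C * q)).
  assert (HS0 : S q <= 0) by nra.
  assert (pos_sq (h i q - H) <= S q).
  { apply (sumR_term_le n (fun i => pos_sq (h i q - H))); auto.
    intros; apply pos_sq_nonneg. }
  assert (h i q - H <= 0) by (apply pos_sq_nonpos_arg; lra). lra.
Qed.

(** The barrier [(1 - theta exp (- A (t - p))) H] solves [c' = A (H - c)]. It is nonnegative, so the
    bound on [df] is only used where [0 <= f]. *)
Lemma gap_decay l f df A H theta p q :
  p <= q -> 0 <= A -> 0 <= H -> 0 <= theta <= 1 -> continuity f ->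
  (forall t, p < t < q -> ~ In t l ->
     derivable_pt_lim f t (df t) /\ (0 <= f t -> df t <= A * (H - f t))) ->
  f p <= (1 - theta) * H -> f q <= (1 - theta * exp (- (A * (q - p)))) * H.
Proof.
  intros Hpq HA HH Hth Hf Hd H0.
  apply (scalar_comparison l f df (fun t => (1 - theta * exp (- (A * (t - p)))) * H)
    (fun t => theta * exp (- (A * (t - p))) * A * H) p q); auto.
  - intros t. apply derivable_continuous_pt. reg.
  - intros t Ht Hl. destruct (Hd t Ht Hl) as [Hdf Hle].
    split; [exact Hdf|split].
    + apply is_derive_Reals. auto_derive; [exact I | unfold Rminus; ring].
    + set (E := exp (- (A * (t - p)))). intros Hlt.
      assert (HE : 0 < E <= 1).
      { split; [apply exp_pos|]. apply exp_le_1. nra. }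
      assert (0 <= theta * E <= 1) by nra.
      assert (0 <= (1 - theta * E) * H) by nra.
      assert (df t <= A * (H - f t)) by (apply Hle; lra).
      assert (A * (H - f t) <= A * (H - (1 - theta * E) * H))
        by (apply Rmult_le_compat_l; lra).
      nra.
  - replace (- (A * (p - p))) with 0 by ring. rewrite exp_0. lra.
Qed.

(** The barrier is affine, [(1 - kappa (t - p) theta) H]. On it the right-hand side is at most
    [((A + mu) kappa (q - p) - mu) theta H], and the equation for [kappa] makes this exactly the
    barrier slope [- kappa theta H]. *)
Lemma gap_gain l f df A mu H theta kappa p q :
  p <= q -> 0 <= A -> 0 < mu -> 0 <= H -> 0 <= theta <= 1 -> continuity f ->
  kappa * (1 + (A + mu) * (q - p)) = mu ->
  (forall t, p < t < q -> ~ In t l ->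
     derivable_pt_lim f t (df t) /\
     ((1 - theta) * H <= f t -> df t <= A * (H - f t) + mu * ((1 - theta) * H - f t))) ->
  f p <= H -> f q <= (1 - kappa * (q - p) * theta) * H.
Proof.
  intros Hpq HA Hmu HH Hth Hf Hk Hd H0.
  assert (Hk0 : 0 < kappa).
  { assert (0 <= (A + mu) * (q - p)) by (apply Rmult_le_pos; lra). nra. }
  apply (scalar_comparison l f df (fun t => (1 - kappa * (t - p) * theta) * H)
    (fun t => - (kappa * theta * H)) p q); auto.
  - intros t. apply derivable_continuous_pt. reg.
  - intros t Ht Hl. destruct (Hd t Ht Hl) as [Hdf Hle].
    split; [exact Hdf|split].
    + apply is_derive_Reals. auto_derive; [exact I | ring].
    + intros Hlt.
      assert (Hkt : 0 <= kappa * (t - p)) by (apply Rmult_le_pos; lra).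
      assert (Hkq : kappa * (t - p) <= kappa * (q - p)) by (apply Rmult_le_compat_l; lra).
      assert (HthH : 0 <= theta * H) by (apply Rmult_le_pos; lra).
      assert (H1 : (A + mu) * (kappa * (q - p)) = mu - kappa) by nra.
      (* This keeps the barrier above [(1 - theta) H], so the conditional bound on [df] applies
         wherever [f] exceeds it. *)
      assert (Hk1 : kappa * (q - p) <= 1).
      { assert (0 <= A * (kappa * (q - p))) by (apply Rmult_le_pos; lra). nra. }
      assert (Hdd : df t <= A * (H - f t) + mu * ((1 - theta) * H - f t)).
      { apply Hle. assert (kappa * (t - p) * (theta * H) <= 1 * (theta * H))
          by (apply Rmult_le_compat_r; lra). lra. }
      assert (H2 : (A + mu) * ((1 - kappa * (t - p) * theta) * H) <= (A + mu) * f t)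
        by (apply Rmult_le_compat_l; lra).
      assert (H3 : (A + mu) * (kappa * (t - p)) * (theta * H) <= (mu - kappa) * (theta * H)).
      { apply Rmult_le_compat_r; [lra|]. rewrite <- H1. apply Rmult_le_compat_l; lra. }
      nra.
  - lra.
Qed.

(** * Primitive of a step majorant *)

(** [phi] approximates itself with error 0. The proof is transparent so that the approximating
    sequence computes to the constant [phi] when [RInt] is identified with [RiemannInt_SF]. *)
Lemma stepfun_integrable a b (phi : StepFun a b) : Riemann_integrable phi a b.
Proof.
  intros eps. exists phi, (mkStepFun (StepFun_P4 a b 0)). split.
  - intros t _. rewrite Rminus_diag, Rabs_R0. apply Rle_refl.
  - rewrite StepFun_P18, Rmult_0_l, Rabs_R0. apply cond_pos.
Defined.

Lemma RInt_stepfun a b (phi : StepFun a b) : RInt phi a b = RiemannInt_SF phi.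
Proof.
  rewrite (RInt_Reals _ _ _ (stepfun_integrable a b phi)).
  unfold RiemannInt. destruct (RiemannInt_exists _ RinvN RinvN_cv) as [v Hv].
  apply (UL_sequence _ _ _ Hv). intros eps Heps. exists O. intros m _.
  unfold phi_sequence, stepfun_integrable; simpl.
  unfold Rdist. rewrite Rminus_diag, Rabs_R0. exact Heps.
Qed.

Lemma sequence_gap (e : nat -> R) t : forall m,
  e O < t < e m -> (forall i, (i <= m)%nat -> t <> e i) ->
  exists i, (i < m)%nat /\ e i < t < e (S i).
Proof.
  induction m as [|m IH]; intros Ht Hne; [lra|].
  destruct (Rlt_dec (e m) t) as [H|H].
  - exists m. split; [lia|lra].
  - destruct IH as (i & Hi & Hti).
    + assert (t <> e m) by (apply Hne; lia). lra.
    + intros i Hi; apply Hne; lia.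
    + exists i. split; [lia|auto].
Qed.

Lemma stepfun_locally_constant a b (phi : StepFun a b) : a <= b ->
  exists l, forall t, a < t < b -> ~ In t l -> locally t (fun s => phi s = phi t).
Proof.
  intros Hab. destruct phi as [phi [l [lf (Hord & H0 & Hlast & Hlen & Hc)]]]; simpl.
  rewrite Rmin_left in H0 by lra. rewrite Rmax_right in Hlast by lra.
  exists l. intros t Ht Hl.
  destruct (sequence_gap (RList.pos_Rl l) t (pred (length l))) as (i & Hi & Hti).
  - rewrite H0, Hlast; exact Ht.
  - intros i Hi Heq. apply Hl. rewrite Heq. apply RList.pos_Rl_P2.
    exists i. split; [rewrite Hlen in *; simpl in *; lia | reflexivity].
  - specialize (Hc i Hi).
    assert (Hd : 0 < Rmin (t - RList.pos_Rl l i) (RList.pos_Rl l (S i) - t))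
      by (apply Rmin_pos; lra).
    exists (mkposreal _ Hd). intros s Hs. change (Rabs (s - t) < Rmin (t - RList.pos_Rl l i) (RList.pos_Rl l (S i) - t)) in Hs.
    assert (Hs1 := Rlt_le_trans _ _ _ Hs (Rmin_l _ _)).
    assert (Hs2 := Rlt_le_trans _ _ _ Hs (Rmin_r _ _)).
    apply Rabs_def2 in Hs1. apply Rabs_def2 in Hs2.
    rewrite (Hc s), (Hc t); [reflexivity| |]; split; lra.
Qed.

(** [J] is Lipschitz because [phi] is bounded, and differentiable wherever [phi] is locally
    constant, that is, off its breakpoints. *)
Lemma stepfun_primitive T (phi : StepFun 0 T) : 0 <= T ->
  exists (J : R -> R) (l : list R), continuity J /\ J 0 = 0 /\ J T = RiemannInt_SF phi /\
    forall t, 0 < t < T -> ~ In t l -> derivable_pt_lim J t (phi t).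
Proof.
  intros HT. destruct (stepfun_locally_constant 0 T phi HT) as [l Hl].
  (* Clamping time to [[0, T]] makes [J] continuous on all of R, as the comparison lemmas
     require. *)
  set (c := fun s => Rmin T (Rmax 0 s)).
  set (J := fun s => RInt phi 0 (c s)).
  assert (Hcr : forall s, 0 <= c s <= T).
  { intros s; unfold c, Rmin, Rmax. destruct (Rle_dec 0 s); destruct (Rle_dec T _); lra. }
  assert (Hcid : forall s, 0 <= s <= T -> c s = s).
  { intros s Hs; unfold c. rewrite Rmax_right by lra. apply Rmin_right; lra. }
  assert (Hex : forall s, 0 <= s <= T -> ex_RInt phi 0 s).
  { intros s Hs. apply (@ex_RInt_Chasles_1 R_CompleteNormedModule phi 0 s T); [lra|].
    apply ex_RInt_Reals_1, stepfun_integrable. }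
  exists J, l. repeat split.
  - destruct (ex_RInt_ub phi 0 T (Hex T (conj HT (Rle_refl T)))) as [M HM].
    rewrite Rmin_left, Rmax_right in HM by lra.
    assert (HM0 : 0 <= M).
    { apply Rle_trans with (2 := HM 0 (conj (Rle_refl 0) HT)). apply norm_ge_0. }
    assert (Hlip : forall r s, 0 <= r -> r <= s -> s <= T ->
      Rabs (RInt phi 0 s - RInt phi 0 r) <= (s - r) * M).
    { intros r s Hr Hrs Hs.
      assert (Hrx : ex_RInt phi r s).
      { apply (@ex_RInt_Chasles_2 R_CompleteNormedModule phi 0); [lra | apply Hex; lra]. }
      rewrite <- (RInt_Chasles phi 0 r s (Hex r ltac:(lra)) Hrx).
      unfold plus; simpl. rewrite Rplus_minus_l.
      apply abs_RInt_le_const; auto. intros; apply HM; lra. }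
    assert (HJ : forall r s, r <= s -> Rabs (J s - J r) <= (s - r) * M).
    { intros r s Hrs. apply Rle_trans with ((c s - c r) * M).
      - assert (c r <= c s).
        { apply Rle_min_compat_l, Rle_max_compat_l, Hrs. }
        apply Hlip; auto; apply Hcr.
      - apply Rmult_le_compat_r; [auto|]. unfold c, Rmin, Rmax.
        repeat destruct (Rle_dec _ _); lra. }
    intros t eps Heps. exists (eps / (M + 1)). split; [apply Rdiv_lt_0_compat; lra|].
    intros s [_ Hs]. simpl in *. unfold R_dist, Rdist in *.
    apply Rle_lt_trans with (Rabs (s - t) * M).
    + destruct (Rle_dec t s).
      * rewrite (Rabs_right (s - t)) by lra. now apply HJ.
      * rewrite (Rabs_left (s - t)) by lra. rewrite Rabs_minus_sym, Ropp_minus_distr.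
        apply HJ; lra.
    + apply (Rmult_lt_compat_r (M + 1)) in Hs; [|lra].
      unfold Rdiv in Hs. rewrite Rmult_assoc, Rinv_l in Hs by lra.
      assert (0 <= Rabs (s - t)) by apply Rabs_pos. nra.
  - unfold J. rewrite Hcid by lra. rewrite RInt_point. reflexivity.
  - unfold J. rewrite Hcid by lra. apply RInt_stepfun.
  - intros t Ht Hlt. apply is_derive_Reals.
    assert (Hin : locally t (fun s => 0 <= s <= T)).
    { apply filter_imp with (fun s => 0 < s /\ s < T); [intros; lra|].
      apply filter_and; [apply (open_gt 0 t) | apply (open_lt T t)]; lra. }
    apply (is_derive_ext_loc (fun s => RInt phi 0 s)).
    + apply filter_imp with (2 := Hin). intros s Hs. unfold J. now rewrite Hcid.
    + apply (is_derive_RInt phi _ 0 t).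
      * apply filter_imp with (2 := Hin). intros s Hs.
        apply (@RInt_correct R_CompleteNormedModule phi), Hex, Hs.
      * apply continuous_ext_loc with (fun _ => phi t); [|apply continuous_const].
        apply filter_imp with (2 := Hl t Ht Hlt). intros s Hs. now rewrite Hs.
Qed.

(** Riemann integrability supplies step functions with [|f - phi| <= psi] and a small integral of
    [psi]; the majorant is [phi + psi]. Half of [eps] pays for the integral of [phi], half for that
    of [psi]. *)
Lemma integrable_majorant_primitive f T (pr : Riemann_integrable f 0 T) eps :
  0 <= T -> 0 < eps ->
  exists (J Z : R -> R) (l : list R), continuity J /\ J 0 = 0 /\
    J T <= RiemannInt pr + eps /\
    forall t, 0 < t < T -> ~ In t l -> derivable_pt_lim J t (Z t) /\ f t <= Z t.
Proof.
  intros HT Heps. unfold RiemannInt.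
  destruct (RiemannInt_exists pr RinvN RinvN_cv) as [v Hv].
  assert (He2 : eps / 2 > 0) by lra.
  destruct (Hv _ He2) as [N1 HN1]. destruct (RinvN_cv He2) as [N2 HN2].
  set (N := Nat.max N1 N2).
  specialize (HN1 N ltac:(unfold N; lia)). specialize (HN2 N ltac:(unfold N; lia)).
  destruct (phi_sequence_prop RinvN pr N) as [psi [Hpsi Hpsi2]].
  set (phi := phi_sequence RinvN pr N) in *.
  destruct (stepfun_primitive T (mkStepFun (StepFun_P28 1 phi psi)) HT)
    as (J & l & HJc & HJ0 & HJT & HJd).
  exists J, (fun t => phi t + 1 * psi t), l. repeat split; auto.
  - rewrite HJT, StepFun_P30. unfold Rdist in *.
    apply Rabs_def2 in HN1. apply Rabs_def2 in HN2. apply Rabs_def2 in Hpsi2. lra.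
  - specialize (Hpsi t). rewrite Rmin_left, Rmax_right in Hpsi by lra.
    specialize (Hpsi ltac:(lra)). assert (Ha := Rle_abs (f t - phi t)). lra.
Qed.

(** * Contraction over jointly connected windows *)

Lemma switching_digraph n k sigma t :
  admissible_switching n k sigma -> 0 <= t ->
  is_digraph_on n k (sigma t) /\ no_arc_into_leader (sigma t).
Proof.
  intros [(P & HP & HG) _] Ht. destruct (HG t Ht) as (G & HGin & HGeq).
  destruct (HP G HGin) as [Hd Hl]. split.
  - intros u v Huv. apply Hd. now rewrite <- HGeq.
  - intros u j. rewrite HGeq. apply Hl.
Qed.

(** The spacing gives [sw m >= m tauD], so the instants are unbounded and the intervals cover the
    half line. This serves the switching instants and later the regular grid of windows. *)
Lemma dwell_cover (sw : nat -> R) tauD : 0 < tauD -> sw O = 0 ->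
  (forall m, sw (S m) - sw m >= tauD) ->
  forall s, 0 <= s -> exists m, sw m <= s < sw (S m).
Proof.
  intros Htau H0 Hd s Hs.
  assert (Hlin : forall m, INR m * tauD <= sw m).
  { induction m as [|m IH]; [simpl; lra|]. rewrite S_INR. specialize (Hd m). lra. }
  destruct (INR_unbounded (s / tauD)) as [N HN].
  assert (HsN : s < sw N).
  { apply Rlt_le_trans with (2 := Hlin N). apply (Rmult_lt_compat_r tauD) in HN; [|lra].
    unfold Rdiv in HN. rewrite Rmult_assoc, Rinv_l in HN by lra. lra. }
  clear - HsN H0 Hs. induction N as [|N IH]; [lra|].
  destruct (Rlt_dec s (sw N)); [auto|]. exists N. lra.
Qed.

Lemma arc_dwell n k sigma : admissible_switching n k sigma ->
  exists delta, 0 < delta /\ forall s u v, delta <= s -> sigma s u v = true ->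
    exists p, s - delta <= p <= s /\
      forall t, p <= t < p + delta -> sigma t u v = true.
Proof.
  intros [_ (tauD & sw & Htau & H0 & Hd & Hsw)].
  (* The constancy interval containing [s] has length at least [tauD], so half a dwell time fits
     either after [s] or before it. *)
  exists (tauD / 2). split; [lra|]. intros s u v Hs Huv.
  destruct (dwell_cover sw tauD Htau H0 Hd s) as [m Hm]; [lra|].
  specialize (Hd m). specialize (Hsw m).
  assert (Hall : forall t, sw m <= t < sw (S m) -> sigma t u v = true).
  { intros t Ht. rewrite (Hsw t Ht), <- (Hsw s Hm). exact Huv. }
  destruct (Rle_dec (s + tauD / 2) (sw (S m))).
  - exists s. split; [lra|]. intros t Ht. apply Hall. lra.
  - exists (s - tauD / 2). split; [lra|]. intros t Ht. apply Hall. lra.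
Qed.

(** Walking back from the end of the path, which lies outside [l], the first predecessor that is a
    leader or a member of [l] gives the crossing arc. *)
Lemma dpath_enters_complement (E : vertex -> vertex -> Prop) (l : list nat) u v :
  dpath E u v -> (exists j, u = VL j) -> forall i, v = VF i -> ~ In i l ->
  exists u' i', E u' (VF i') /\ ~ In i' l /\ (forall m, u' = VF m -> In m l).
Proof.
  intros Hp [j Hj]. induction Hp as [u v Huv | u w v Hp IH Hwv]; intros i Hv Hi; subst.
  - exists (VL j), i. repeat split; auto. intros m Hm; discriminate.
  - destruct w as [m|m].
    + destruct (in_dec PeanoNat.Nat.eq_dec m l) as [Hin|Hout].
      * exists (VF m), i. repeat split; auto. intros m' Hm. now injection Hm as <-.
      * apply (IH eq_refl m eq_refl Hout).
    + exists (VL m), i. repeat split; auto. intros m' Hm; discriminate.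
Qed.

Lemma entering_arc n k sigma t1 t2 l :
  admissible_switching n k sigma -> 0 <= t1 ->
  L_connected n k (joint_arcs sigma t1 t2) ->
  (exists i, (i < n)%nat /\ ~ In i l) ->
  exists s u i, t1 <= s < t2 /\ sigma s u (VF i) = true /\ (i < n)%nat /\ ~ In i l /\
    ((exists j, u = VL j /\ (j < k)%nat) \/ (exists m, u = VF m /\ (m < n)%nat /\ In m l)).
Proof.
  intros Hs Ht1 HL (i & Hi & Hil). destruct (HL i Hi) as (j & Hj & Hp).
  destruct (dpath_enters_complement _ l _ _ Hp (ex_intro _ j eq_refl) i eq_refl Hil)
    as (u & i' & (s & Hst & Hsu) & Hi' & Hu).
  destruct (switching_digraph n k sigma s Hs ltac:(lra)) as [Hdig _].
  destruct (Hdig _ _ Hsu) as [Hvu Hvi].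
  exists s, u, i'. repeat split; auto; try lra.
  destruct u as [m|m]; [right|left]; exists m; auto.
Qed.

Lemma finite_split n (l : list nat) :
  (forall i, (i < n)%nat -> In i l) \/ exists i, (i < n)%nat /\ ~ In i l.
Proof.
  induction n as [|n [IH|(i & Hi & Hl)]].
  - left; intros; lia.
  - destruct (in_dec PeanoNat.Nat.eq_dec n l) as [H|H].
    + left. intros i Hi. destruct (PeanoNat.Nat.eq_dec i n) as [->|]; [auto|apply IH; lia].
    + right. exists n. auto.
  - right. exists i. auto.
Qed.

(** [mu] bounds the weights of active arcs of both kinds from below. The remaining bounds on [al]
    belong to [cooperative], which sees [be] only through its sum over the leaders. *)
Definition arc_coeffs (n k : nat) (sigma : R -> digraph) (mu : R)
  (al be : nat -> nat -> R -> R) : Prop :=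
  forall t i, 0 <= t -> (i < n)%nat ->
    (forall j, (j < n)%nat -> sigma t (VF j) (VF i) = true -> mu <= al i j t) /\
    (forall j, (j < k)%nat -> 0 <= be i j t) /\
    (forall j, (j < k)%nat -> sigma t (VL j) (VF i) = true -> mu <= be i j t).

Lemma cooperative_term_bound n a_hi (al h : nat -> R) hi H :
  0 <= a_hi -> hi <= H ->
  (forall j, (j < n)%nat -> h j <= H) -> (forall j, (j < n)%nat -> 0 <= al j <= a_hi) ->
  sumR n (fun j => al j * (h j - hi)) <= INR n * a_hi * (H - hi).
Proof.
  intros Ha HhH Hh Hal. rewrite Rmult_assoc, <- sumR_const. apply sumR_le.
  intros j Hj. specialize (Hh j Hj). specialize (Hal j Hj).
  apply Rle_trans with (al j * (H - hi)).
  - apply Rmult_le_compat_l; lra.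
  - apply Rmult_le_compat_r; lra.
Qed.

Lemma cooperative_term_bound_arc n a_hi (al h : nat -> R) hi H mu v m :
  0 <= a_hi -> 0 <= mu -> v <= hi <= H -> (m < n)%nat -> h m <= v -> mu <= al m ->
  (forall j, (j < n)%nat -> h j <= H) -> (forall j, (j < n)%nat -> 0 <= al j <= a_hi) ->
  sumR n (fun j => al j * (h j - hi)) <= INR n * a_hi * (H - hi) + mu * (v - hi).
Proof.
  intros Ha Hmu HhH Hm Hhm Halm Hh Hal.
  (* The slacks of all terms are nonnegative, and that of the active arc from [m] alone is at least
     [mu (hi - v)]. *)
  set (slack := fun j => a_hi * (H - hi) - al j * (h j - hi)).
  assert (Hs0 : forall j, (j < n)%nat -> 0 <= slack j).
  { intros j Hj. specialize (Hh j Hj). specialize (Hal j Hj). unfold slack.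
    assert (al j * (h j - hi) <= al j * (H - hi)) by (apply Rmult_le_compat_l; lra).
    assert (al j * (H - hi) <= a_hi * (H - hi)) by (apply Rmult_le_compat_r; lra). lra. }
  assert (Hsum : slack m <= sumR n slack) by (apply sumR_term_le; auto).
  assert (Heq : sumR n slack + sumR n (fun j => al j * (h j - hi)) = INR n * a_hi * (H - hi)).
  { rewrite <- sumR_plus, Rmult_assoc, <- sumR_const. apply sumR_ext.
    intros j Hj. unfold slack. ring. }
  assert (mu * (v - hi) >= slack m * -1).
  { unfold slack. assert (0 <= a_hi * (H - hi)) by (apply Rmult_le_pos; lra).
    assert (al m * (h m - hi) <= al m * (v - hi)) by (apply Rmult_le_compat_l; lra).
    assert ((al m - mu) * (v - hi) <= 0) by nra. nra. }
  nra.
Qed.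

Lemma cooperative_le n a_hi l p q al B h dh H t :
  0 <= a_hi -> 0 <= H -> cooperative n a_hi l p q al B h dh ->
  (forall i, (i < n)%nat -> h i p <= H) -> p <= t <= q ->
  forall i, (i < n)%nat -> h i t <= H.
Proof.
  intros Ha HH Hco H0 Ht. apply (max_principle n a_hi l p t al B h dh); auto; [lra|].
  apply (cooperative_sub n a_hi l p q); auto; lra.
Qed.

Lemma cooperative_gap_decay n a_hi l p q al B h dh H theta i :
  p <= q -> 0 <= a_hi -> 0 <= H -> 0 <= theta <= 1 ->
  cooperative n a_hi l p q al B h dh ->
  (forall i, (i < n)%nat -> h i p <= H) -> (i < n)%nat ->
  h i p <= (1 - theta) * H ->
  h i q <= (1 - theta * exp (- (INR n * a_hi * (q - p)))) * H.
Proof.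
  intros Hpq Ha HH Hth Hco H0 Hi Hip.
  apply (gap_decay l (h i) (dh i)); auto.
  - apply Rmult_le_pos; [apply pos_INR | auto].
  - now apply Hco.
  - intros t Ht Hl.
    assert (Hall : forall j, (j < n)%nat -> h j t <= H).
    { apply (cooperative_le n a_hi l p q al B h dh); auto; lra. }
    destruct Hco as [_ Hd].
    destruct (Hd t Ht Hl i Hi) as (Hder & Hle & Hal & HB). split; [exact Hder|].
    intros Hpos.
    assert (Hb := cooperative_term_bound n a_hi (fun j => al i j t) (fun j => h j t)
      (h i t) H Ha (Hall i Hi) Hall Hal).
    assert (0 <= B i t * h i t) by now apply Rmult_le_pos.
    simpl in Hb. lra.
Qed.

Lemma gap_weaken theta x y H v :
  0 <= theta -> 0 <= H -> y <= x -> v <= (1 - theta * x) * H -> v <= (1 - theta * y) * H.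
Proof.
  intros Hth HH Hyx Hv. apply Rle_trans with (1 := Hv).
  apply Rmult_le_compat_r; [auto|].
  assert (theta * y <= theta * x) by now apply Rmult_le_compat_l. lra.
Qed.

Lemma exp_opp_le A r s : 0 <= A -> r <= s -> exp (- (A * s)) <= exp (- (A * r)).
Proof.
  intros HA Hrs. replace (- (A * s)) with (- (A * r) + - (A * (s - r))) by ring.
  rewrite exp_plus. rewrite <- (Rmult_1_r (exp (- (A * r)))) at 2.
  apply Rmult_le_compat_l; [left; apply exp_pos|]. apply exp_le_1.
  assert (0 <= A * (s - r)) by (apply Rmult_le_pos; lra). lra.
Qed.

(** [S] lists followers with relative gap [theta]. In the factor [kappa delta E^2], with [E] the
    exponential, one [E] is the decay of the tail's gap before and during the arc, [kappa delta] is
    the gain across the arc, and the other [E] is the decay until the window ends. The margins of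
    length [delta] on both sides keep the whole activity interval inside the window. *)
Lemma window_step n k sigma a_hi mu delta T kappa l al be h dh H theta s S :
  admissible_switching n k sigma -> 0 <= a_hi -> 0 < mu -> 0 < delta -> 0 < T ->
  (forall s u v, delta <= s -> sigma s u v = true ->
    exists p, s - delta <= p <= s /\
      forall t, p <= t < p + delta -> sigma t u v = true) ->
  kappa * (1 + (INR n * a_hi + mu) * delta) = mu ->
  0 <= H -> 0 <= theta <= 1 -> 0 <= s ->
  L_connected n k (joint_arcs sigma (s + delta) (s + delta + T)) ->
  arc_coeffs n k sigma mu al be ->
  cooperative n a_hi l s (s + (T + 2 * delta)) al (fun i t => sumR k (fun j => be i j t)) h dh ->
  (forall i, (i < n)%nat -> h i s <= H) ->
  NoDup S -> (forall i, In i S -> (i < n)%nat) ->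
  (forall i, In i S -> h i s <= (1 - theta) * H) ->
  exists S', NoDup S' /\ (forall i, In i S' -> (i < n)%nat) /\
    (length S' = Datatypes.S (length S) \/ forall i, (i < n)%nat -> In i S') /\
    forall i, In i S' -> h i (s + (T + 2 * delta)) <=
      (1 - theta * (kappa * delta * exp (- (INR n * a_hi * (T + 2 * delta))) ^ 2)) * H.
Proof.
  intros Hsig Ha Hmu Hdel HT Hdw Hkap HH Hth Hs HL Hcoef Hco H0 Hnd Hlt HS.
  set (A := INR n * a_hi) in *. set (D := T + 2 * delta) in *. set (E := exp (- (A * D))).
  assert (HA : 0 <= A) by (apply Rmult_le_pos; [apply pos_INR | auto]).
  assert (HD : 0 < D) by (unfold D; lra).
  assert (HE : 0 < E <= 1).
  { split; [apply exp_pos|]. apply exp_le_1.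
    assert (0 <= A * D) by (apply Rmult_le_pos; lra). lra. }
  assert (HAd : 0 <= (A + mu) * delta) by (apply Rmult_le_pos; lra).
  assert (Hk0 : 0 < kappa) by nra.
  assert (Hkd : 0 < kappa * delta <= 1).
  { split; [now apply Rmult_lt_0_compat|].
    assert (0 <= A * (kappa * delta)) by (apply Rmult_le_pos; nra). nra. }
  assert (Hall : forall t i, s <= t <= s + D -> (i < n)%nat -> h i t <= H).
  { intros t i Ht. revert i. now apply (cooperative_le n a_hi l s (s + D) al
      (fun i t => sumR k (fun j => be i j t)) h dh). }
  assert (Hkeep : forall t i, s <= t <= s + D -> In i S -> h i t <= (1 - theta * E) * H).
  { intros t i Ht Hi. apply (gap_weaken theta (exp (- (A * (t - s))))); auto; [lra| |].
    - apply exp_opp_le; [auto|lra].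
    - apply (cooperative_gap_decay n a_hi l s t al (fun i t => sumR k (fun j => be i j t)) h dh);
        auto; [lra|].
      apply (cooperative_sub n a_hi l s (s + D)); auto; lra. }
  (* Old members lose only the factor [E]; this weakens their gap to the common factor. *)
  assert (HrhoE : kappa * delta * E ^ 2 <= E) by nra.
  assert (Hold : forall i, In i S -> h i (s + D) <= (1 - theta * (kappa * delta * E ^ 2)) * H).
  { intros i Hi. apply (gap_weaken theta E); auto; [lra|]. apply Hkeep; auto; lra. }
  destruct (finite_split n S) as [Hfull|Hout].
  - exists S. auto.
  - destruct (entering_arc n k sigma (s + delta) (s + delta + T) S Hsig ltac:(lra) HL Hout)
      as (s0 & u & v & Hs0 & Huv & Hvn & HvS & Hu).
    destruct (Hdw s0 u (VF v) ltac:(lra) Huv) as (p & Hp & Hact).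
    assert (HthE : 0 <= theta * E <= 1) by nra.
    assert (Hgain : h v (p + delta) <= (1 - kappa * (p + delta - p) * (theta * E)) * H).
    { apply (gap_gain l (h v) (dh v) A mu); auto; try lra.
      - now apply Hco.
      - intros t Ht Hl. destruct Hco as [Hc Hd].
        assert (HtD : s < t < s + D) by (unfold D; lra).
        destruct (Hd t HtD Hl v Hvn) as (Hder & Hle & Hal & HB).
        split; [exact Hder|]. intros Hge.
        assert (Htall : forall j, (j < n)%nat -> h j t <= H) by (intros; apply Hall; auto; lra).
        assert (Hpos : 0 <= h v t).
        { apply Rle_trans with (2 := Hge). apply Rmult_le_pos; lra. }
        destruct (Hcoef t v ltac:(lra) Hvn) as (HcF & Hbe & HcL).
        assert (Hactt : sigma t u (VF v) = true) by (apply Hact; lra).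
        (* A leader tail pulls towards 0, which lies below [(1 - theta E) H]; a follower tail in [S]
           has a value below that level by [Hkeep]. *)
        apply Rle_trans with (1 := Hle). destruct Hu as [(j & -> & Hj)|(m & -> & Hm & HmS)].
        + assert (Hb := cooperative_term_bound n a_hi (fun j => al v j t) (fun j => h j t)
            (h v t) H Ha (Htall v Hvn) Htall Hal). simpl in Hb. fold A in Hb.
          assert (mu <= sumR k (fun j => be v j t)).
          { apply Rle_trans with (be v j t); [now apply HcL|].
            apply (sumR_term_le k (fun j => be v j t)); auto. }
          assert (mu * h v t <= sumR k (fun j => be v j t) * h v t)
            by now apply Rmult_le_compat_r.
          assert (0 <= mu * ((1 - theta * E) * H))
            by (apply Rmult_le_pos; [|apply Rmult_le_pos]; lra).
          nra.
        + assert (Hb := cooperative_term_bound_arc n a_hi (fun j => al v j t) (fun j => h j t)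
            (h v t) H mu ((1 - theta * E) * H) m Ha (Rlt_le _ _ Hmu)
            (conj Hge (Htall v Hvn)) Hm (Hkeep t m ltac:(lra) HmS) (HcF m Hm Hactt) Htall Hal).
          simpl in Hb. fold A in Hb.
          assert (0 <= sumR k (fun j => be v j t) * h v t) by now apply Rmult_le_pos.
          lra.
      - apply Hall; auto. unfold D. lra. }
    replace (p + delta - p) with delta in Hgain by ring.
    exists (v :: S). repeat split.
    + now constructor.
    + intros i [<-|Hi]; auto.
    + left; reflexivity.
    + intros i [<-|Hi]; [|now apply Hold].
      replace (theta * (kappa * delta * E ^ 2)) with (kappa * delta * (theta * E) * E) by ring.
      apply (gap_weaken _ (exp (- (A * (s + D - (p + delta)))))); auto.
      * apply Rmult_le_pos; lra.
      * apply exp_opp_le; auto. lra.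
      * assert (Hpd : s <= p + delta <= s + D) by (unfold D; lra).
        apply (cooperative_gap_decay n a_hi l (p + delta) (s + D) al
          (fun i t => sumR k (fun j => be i j t)) h dh); auto; try lra.
        -- split; [apply Rmult_le_pos; lra|]. nra.
        -- apply (cooperative_sub n a_hi l s (s + D)); auto; lra.
Qed.

(** After [r] windows either [r] distinct followers or all of them have relative gap [rho ^ r], so
    [n] windows reach everyone. *)
Lemma windows_contraction n k sigma a_hi mu delta T kappa l al be h dh H s :
  admissible_switching n k sigma -> 0 <= a_hi -> 0 < mu -> 0 < delta -> 0 < T ->
  (forall s u v, delta <= s -> sigma s u v = true ->
    exists p, s - delta <= p <= s /\
      forall t, p <= t < p + delta -> sigma t u v = true) ->
  kappa * (1 + (INR n * a_hi + mu) * delta) = mu ->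
  0 <= H -> 0 <= s ->
  (forall t, 0 <= t -> L_connected n k (joint_arcs sigma t (t + T))) ->
  arc_coeffs n k sigma mu al be ->
  cooperative n a_hi l s (s + INR n * (T + 2 * delta)) al
    (fun i t => sumR k (fun j => be i j t)) h dh ->
  (forall i, (i < n)%nat -> h i s <= H) ->
  forall i, (i < n)%nat -> h i (s + INR n * (T + 2 * delta)) <=
    (1 - (kappa * delta * exp (- (INR n * a_hi * (T + 2 * delta))) ^ 2) ^ n) * H.
Proof.
  intros Hsig Ha Hmu Hdel HT Hdw Hkap HH Hs HL Hcoef Hco H0.
  set (D := T + 2 * delta) in *.
  set (rho := kappa * delta * exp (- (INR n * a_hi * D)) ^ 2).
  assert (HA : 0 <= INR n * a_hi) by (apply Rmult_le_pos; [apply pos_INR | auto]).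
  assert (HD : 0 < D) by (unfold D; lra).
  assert (Hrho : 0 <= rho <= 1).
  { assert (HE : 0 < exp (- (INR n * a_hi * D)) <= 1).
    { split; [apply exp_pos|]. apply exp_le_1.
      assert (0 <= INR n * a_hi * D) by (apply Rmult_le_pos; lra). lra. }
    assert (0 <= (INR n * a_hi + mu) * delta) by (apply Rmult_le_pos; lra).
    assert (Hk0 : 0 < kappa) by nra.
    assert (Hkd : 0 < kappa * delta <= 1).
    { split; [now apply Rmult_lt_0_compat|].
      assert (0 <= INR n * a_hi * (kappa * delta)) by (apply Rmult_le_pos; nra). nra. }
    unfold rho. set (E := exp _) in *. assert (0 <= E ^ 2 <= 1) by nra. nra. }
  assert (Hgrow : forall r, (r <= n)%nat -> exists S, NoDup S /\
    (forall i, In i S -> (i < n)%nat) /\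
    (length S = r \/ forall i, (i < n)%nat -> In i S) /\
    forall i, In i S -> h i (s + INR r * D) <= (1 - rho ^ r) * H).
  { induction r as [|r IH]; intros Hr.
    - exists nil. repeat split; [constructor | easy | now left | easy].
    - destruct IH as (S & Hnd & HSn & Hlen & HSb); [lia|].
      assert (HrD : 0 <= INR r * D) by (apply Rmult_le_pos; [apply pos_INR|lra]).
      assert (Hrn : INR (Datatypes.S r) * D <= INR n * D).
      { apply Rmult_le_compat_r; [lra|]. now apply le_INR. }
      assert (Heq : s + INR (Datatypes.S r) * D = s + INR r * D + D)
        by (rewrite S_INR; ring).
      destruct (window_step n k sigma a_hi mu delta T kappa l al be h dh H (rho ^ r)
        (s + INR r * D) S) as (S' & Hnd' & HSn' & Hlen' & HSb'); auto; try lra.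
      + split; [apply pow_le; lra|]. rewrite <- (pow1 r). apply pow_incr; lra.
      + apply HL. lra.
      + apply (cooperative_sub n a_hi l s (s + INR n * D)); auto; fold D; lra.
      + apply (cooperative_le n a_hi l s (s + INR n * D) al
          (fun i t => sumR k (fun j => be i j t)) h dh); auto. lra.
      + fold D in HSb'. fold rho in HSb'.
        destruct Hlen as [Hlen|Hfull].
        * exists S'. rewrite Heq. split; [auto|split; [auto|split]].
          -- rewrite <- Hlen. auto.
          -- intros i Hi. simpl. rewrite (Rmult_comm rho). auto.
        * exists S'. rewrite Heq. split; [auto|split; [auto|split]].
          (* Once [S] contains all [n] followers, a duplicate-free [S'] that is longer would have
             more than [n] members. *)
          -- destruct Hlen' as [Hlen'|Hfull']; [|auto]. exfalso.
             assert (length S' <= n)%nat.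
             { rewrite <- (length_seq n 0). apply NoDup_incl_length; auto.
               intros i Hi. apply in_seq. specialize (HSn' i Hi). lia. }
             assert (n <= length S)%nat.
             { rewrite <- (length_seq n 0). apply NoDup_incl_length; [apply seq_NoDup|].
               intros i Hi. apply in_seq in Hi. apply Hfull. lia. }
             lia.
          -- intros i Hi. simpl. rewrite (Rmult_comm rho). auto. }
  destruct (Hgrow n (le_n n)) as (S & Hnd & HSn & Hlen & HSb).
  intros i Hi. apply HSb. destruct Hlen as [Hlen|Hfull]; [|auto].
  apply (NoDup_length_incl Hnd (l' := seq 0 n)).
  - rewrite length_seq. lia.
  - intros m Hm. apply in_seq. specialize (HSn m Hm). lia.
  - apply in_seq. lia.
Qed.

(** * Distance to the convex hull and support functions *)

Lemma argmax_exists k (f : nat -> R) : (1 <= k)%nat ->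
  exists j, (j < k)%nat /\ forall i, (i < k)%nat -> f i <= f j.
Proof.
  intros Hk. induction k as [|k IH]; [lia|]. destruct k as [|k].
  - exists O. split; [lia|]. intros i Hi. replace i with O by lia. lra.
  - destruct IH as (j & Hj & Hmax); [lia|]. destruct (Rle_dec (f (S k)) (f j)).
    + exists j. split; [lia|]. intros i Hi.
      destruct (PeanoNat.Nat.eq_dec i (S k)) as [-> |]; [auto|apply Hmax; lia].
    + exists (S k). split; [lia|]. intros i Hi.
      destruct (PeanoNat.Nat.eq_dec i (S k)) as [-> |]; [lra|].
      apply Rle_trans with (f j); [apply Hmax; lia|lra].
Qed.

Lemma maxR_nonneg m f : 0 <= maxR m f.
Proof.
  induction m as [|m IH]; simpl; [lra|]. apply Rle_trans with (1 := IH), Rmax_l.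
Qed.

Lemma maxR_ge m f i : (i < m)%nat -> f i <= maxR m f.
Proof.
  induction m as [|m IH]; intros Hi; [lia|]. simpl.
  destruct (PeanoNat.Nat.eq_dec i m) as [-> |]; [apply Rmax_r|].
  apply Rle_trans with (maxR m f); [apply IH; lia|apply Rmax_l].
Qed.

(** [maxR] starts from 0, hence the requirement [0 <= B]. *)
Lemma maxR_le m f B : 0 <= B -> (forall i, (i < m)%nat -> f i <= B) -> maxR m f <= B.
Proof.
  intros HB. induction m as [|m IH]; intros H; simpl; [auto|].
  apply Rmax_lub; [apply IH; intros; apply H; lia | apply H; lia].
Qed.

Definition dot (d : nat) (u v : vec) : R := sumR d (fun c => u c * v c).

Lemma dot_self_nonneg d v : 0 <= dot d v v.
Proof. apply sumR_nonneg. intros c _. apply Rle_0_sqr. Qed.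

Lemma normd_sq d v : normd d v * normd d v = dot d v v.
Proof.
  unfold normd. rewrite (sumR_ext d _ (fun c => v c * v c)) by (intros; ring).
  apply sqrt_sqrt, dot_self_nonneg.
Qed.

Lemma normd_nonneg d v : 0 <= normd d v.
Proof. apply sqrt_pos. Qed.

Lemma dot_scal_l d a u v : dot d (fun c => a * u c) v = a * dot d u v.
Proof. unfold dot. rewrite <- sumR_scal. apply sumR_ext. intros; ring. Qed.

Lemma dot_sub_r d u v w : dot d u (fun c => v c - w c) = dot d u v - dot d u w.
Proof.
  assert (H : dot d u (fun c => v c - w c) + dot d u w = dot d u v).
  { unfold dot. rewrite <- sumR_plus. apply sumR_ext. intros; ring. }
  lra.
Qed.

Lemma dot_lincomb_self d a b u v :
  dot d (fun c => a * u c + b * v c) (fun c => a * u c + b * v c) =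
  a * a * dot d u u + 2 * a * b * dot d u v + b * b * dot d v v.
Proof.
  unfold dot. rewrite <- !sumR_scal, <- !sumR_plus. apply sumR_ext. intros; ring.
Qed.

(** Cauchy-Schwarz for a unit vector: the square of [v - (eta . v) eta] is [|v|^2 - (eta . v)^2]. *)
Lemma dot_unit_le d eta v : dot d eta eta = 1 -> dot d eta v <= normd d v.
Proof.
  intros He. assert (H := dot_self_nonneg d (fun c => 1 * v c + - dot d eta v * eta c)).
  rewrite dot_lincomb_self, He in H.
  assert (Hc : dot d v eta = dot d eta v) by (apply sumR_ext; intros; ring).
  rewrite Hc in H. assert (Hn := normd_sq d v). assert (Hp := normd_nonneg d v).
  apply Rnot_lt_le. intros Hlt. nra.
Qed.

Lemma dot_unit_abs_le d eta v : dot d eta eta = 1 -> Rabs (dot d eta v) <= normd d v.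
Proof.
  intros He. apply Rabs_le. split; [|now apply dot_unit_le].
  assert (Hm : dot d (fun c => -1 * eta c) (fun c => -1 * eta c) = 1).
  { rewrite <- He. apply sumR_ext. intros; ring. }
  assert (H := dot_unit_le d _ v Hm). rewrite dot_scal_l in H. lra.
Qed.

Lemma vertex_in_hull k d Y j : (j < k)%nat -> in_hull k d Y (Y j).
Proof.
  intros Hj.
  assert (Hsel : forall f : nat -> R,
    sumR k (fun i => (if PeanoNat.Nat.eq_dec i j then 1 else 0) * f i) = f j).
  { clear - Hj. intros f. induction k as [|k IH]; [lia|]. simpl.
    destruct (PeanoNat.Nat.eq_dec k j) as [-> |Hne].
    - rewrite (sumR_ext j _ (fun _ => 0)), sumR_const; [ring|].
      intros i Hi. destruct (PeanoNat.Nat.eq_dec i j); [lia|ring].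
    - rewrite IH by lia. ring. }
  exists (fun i => if PeanoNat.Nat.eq_dec i j then 1 else 0). repeat split.
  - intros i _. destruct (PeanoNat.Nat.eq_dec i j); lra.
  - apply eq_trans with (2 := Hsel (fun _ => 1)). apply sumR_ext. intros; ring.
  - intros c _. now rewrite (Hsel (fun i => Y i c)).
Qed.

Lemma hull_segment k d Y p q s : 0 <= s <= 1 -> in_hull k d Y p -> in_hull k d Y q ->
  in_hull k d Y (fun c => (1 - s) * p c + s * q c).
Proof.
  intros Hs (lp & Hp0 & Hp1 & Hp) (lq & Hq0 & Hq1 & Hq).
  exists (fun j => (1 - s) * lp j + s * lq j). repeat split.
  - intros j Hj. specialize (Hp0 j Hj). specialize (Hq0 j Hj).
    apply Rplus_le_le_0_compat; apply Rmult_le_pos; lra.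
  - rewrite sumR_plus, !sumR_scal, Hp1, Hq1. ring.
  - intros c Hc. rewrite (Hp c Hc), (Hq c Hc), <- !sumR_scal, <- sumR_plus.
    apply sumR_ext. intros; ring.
Qed.

Lemma dot_hull_le k d Y p eta M : in_hull k d Y p ->
  (forall j, (j < k)%nat -> dot d eta (Y j) <= M) -> dot d eta p <= M.
Proof.
  intros (lam & H0 & H1 & Hp) HM.
  assert (Heq : dot d eta p = sumR k (fun j => lam j * dot d eta (Y j))).
  { unfold dot.
    rewrite (sumR_ext d _ (fun c => sumR k (fun j => lam j * (eta c * Y j c)))).
    - rewrite sumR_swap. apply sumR_ext. intros j _. apply sumR_scal.
    - intros c Hc. rewrite (Hp c Hc), <- sumR_scal. apply sumR_ext. intros; ring. }
  rewrite Heq, <- (Rmult_1_r M), <- H1, <- sumR_scal. apply sumR_le. intros j Hj.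
  rewrite Rmult_comm. apply Rmult_le_compat_r; auto.
Qed.

(** [Inf] is a choice, meaningful once an infimum exists. Completeness is applied to the negated
    distances, which are bounded by 0; the set is inhabited through the vertex [Y 0], using
    [1 <= k]. *)
Lemma hull_dist_is_inf k d Y v : (1 <= k)%nat ->
  is_inf (fun r => exists p, in_hull k d Y p /\ r = normd d (fun c => v c - p c))
    (hull_dist k d Y v).
Proof.
  intros Hk. unfold hull_dist, Inf. apply epsilon_spec.
  set (E := fun r => exists p, in_hull k d Y p /\ r = normd d (fun c => v c - p c)).
  destruct (completeness (fun r => E (- r))) as [m [Hub Hlub]].
  - exists 0. intros r (p & _ & Hr). assert (H := normd_nonneg d (fun c => v c - p c)). lra.
  - exists (- normd d (fun c => v c - Y O c)), (Y O). split; [|ring].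
    apply vertex_in_hull. lia.
  - exists (- m). split.
    + intros r Hr. assert (- r <= m); [|lra]. apply Hub. now rewrite Ropp_involutive.
    + intros b Hb. assert (m <= - b); [|lra]. apply Hlub. intros r Hr.
      specialize (Hb _ Hr). lra.
Qed.

(** For each hull point [p], [eta . v - M <= eta . (v - p) <= |v - p|]; so [eta . v - M] is a lower
    bound of the distances. *)
Lemma support_le_hull_dist k d Y v eta M : (1 <= k)%nat -> dot d eta eta = 1 ->
  (forall j, (j < k)%nat -> dot d eta (Y j) <= M) ->
  dot d eta v <= M + hull_dist k d Y v.
Proof.
  intros Hk He HM. assert (dot d eta v - M <= hull_dist k d Y v); [|lra].
  apply (hull_dist_is_inf k d Y v Hk). intros r (p & Hp & ->).
  assert (H1 := dot_hull_le k d Y p eta M Hp HM).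
  assert (H2 := dot_unit_le d eta (fun c => v c - p c) He).
  rewrite dot_sub_r in H2. lra.
Qed.

(* If the distance exceeded [B], then at an almost nearest hull point [p] the unit vector
   along [v - p] would give a vertex [Y j] towards which [p] could move to get closer to
   [v] than the infimum.  Almost minimizers avoid any compactness argument. *)
Lemma hull_dist_le_of_support k d Y v B : (1 <= k)%nat -> 0 <= B ->
  (forall eta, dot d eta eta = 1 ->
    exists j, (j < k)%nat /\ dot d eta v <= dot d eta (Y j) + B) ->
  hull_dist k d Y v <= B.
Proof.
  intros Hk HB Hsup. apply Rnot_lt_le. intros HBD.
  destruct (hull_dist_is_inf k d Y v Hk) as [Hlow Hgreat].
  set (D := hull_dist k d Y v) in *.
  (* By the parallelogram identity [Q] bounds the squared distance from any vertex to any hull point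
     [p] with [|v - p|^2 <= D^2 + 1]. *)
  set (Q := 2 * sumR k (fun j => dot d (fun c => v c - Y j c) (fun c => v c - Y j c))
            + 2 * (D * D + 1)).
  assert (HQ : 0 < Q).
  { assert (0 <= sumR k (fun j => dot d (fun c => v c - Y j c) (fun c => v c - Y j c))).
    { apply sumR_nonneg. intros; apply dot_self_nonneg. }
    unfold Q. nra. }
  set (gap := D * (D - B)).
  assert (Hgap : 0 < gap) by (unfold gap; apply Rmult_lt_0_compat; lra).
  (* [e] is both the accuracy of the near minimizer and the fraction moved towards the vertex. The
     move yields [2 e gap < e^2 (1 + Q)], whereas [e (1 + Q) <= gap]. *)
  set (e := Rmin 1 (gap / (1 + Q))).
  assert (He1 : e <= 1) by apply Rmin_l.
  assert (He2 : e * (1 + Q) <= gap).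
  { apply Rle_trans with (gap / (1 + Q) * (1 + Q)).
    - apply Rmult_le_compat_r; [lra|apply Rmin_r].
    - right. field. lra. }
  assert (He0 : 0 < e).
  { apply Rmin_pos; [lra|]. apply Rdiv_lt_0_compat; lra. }
  assert (Hnear : exists p, in_hull k d Y p /\
    dot d (fun c => v c - p c) (fun c => v c - p c) < D * D + e * e).
  { apply NNPP. intros Hno.
    assert (sqrt (D * D + e * e) <= D).
    { apply Hgreat. intros r (p & Hp & ->).
      rewrite <- (sqrt_square (normd d (fun c => v c - p c))) by apply normd_nonneg.
      apply sqrt_le_1_alt. rewrite normd_sq. apply Rnot_lt_le. intros Hlt.
      apply Hno. now exists p. }
    assert (D < sqrt (D * D + e * e)).
    { rewrite <- (sqrt_square D) at 1 by lra. apply sqrt_lt_1_alt. nra. }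
    lra. }
  destruct Hnear as (p & Hp & Hpn).
  set (f := fun c => v c - p c) in *. set (r := normd d f).
  assert (Hr : r * r = dot d f f) by apply normd_sq.
  assert (HrD : D <= r) by (apply Hlow; now exists p).
  destruct (Hsup (fun c => / r * f c)) as (j & Hj & Hle).
  { rewrite dot_scal_l.
    replace (dot d f (fun c => / r * f c)) with (/ r * dot d f f).
    - rewrite <- Hr. field. lra.
    - rewrite <- dot_scal_l. apply sumR_ext. intros; ring. }
  rewrite !dot_scal_l in Hle.
  set (q := fun c => Y j c - p c).
  assert (Hfv : dot d f v - dot d f (Y j) <= r * B).
  { apply (Rmult_le_compat_l r) in Hle; [|lra].
    rewrite Rmult_plus_distr_l, <- !Rmult_assoc, Rinv_r, !Rmult_1_l in Hle by lra. lra. }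
  assert (Hfq : gap <= dot d f q).
  { unfold q. rewrite dot_sub_r. assert (Hff : dot d f f = dot d f v - dot d f p)
      by apply dot_sub_r. unfold gap. nra. }
  assert (Hqq : dot d q q <= Q).
  { set (g := fun c => v c - Y j c).
    assert (Hq : dot d q q = dot d (fun c => 1 * f c + -1 * g c) (fun c => 1 * f c + -1 * g c))
      by (apply sumR_ext; intros; unfold q, f, g; ring).
    assert (Hpar := dot_self_nonneg d (fun c => 1 * f c + 1 * g c)).
    rewrite dot_lincomb_self in Hpar, Hq.
    assert (Hg : dot d g g <= sumR k (fun j => dot d (fun c => v c - Y j c) (fun c => v c - Y j c))).
    { apply (sumR_term_le k (fun j => dot d (fun c => v c - Y j c) (fun c => v c - Y j c))); auto.
      intros; apply dot_self_nonneg. }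
    unfold Q. nra. }
  assert (Hmove : D * D <= dot d f f - 2 * e * dot d f q + e * e * dot d q q).
  { set (m := fun c => (1 - e) * p c + e * Y j c).
    assert (Hm : in_hull k d Y m).
    { apply hull_segment; [lra|auto|now apply vertex_in_hull]. }
    assert (HDm : D <= normd d (fun c => v c - m c)) by (apply Hlow; now exists m).
    assert (Hms := normd_sq d (fun c => v c - m c)).
    replace (dot d (fun c => v c - m c) (fun c => v c - m c))
      with (dot d (fun c => 1 * f c + - e * q c) (fun c => 1 * f c + - e * q c)) in Hms
      by (apply sumR_ext; intros; unfold f, q, m; ring).
    rewrite dot_lincomb_self in Hms. nra. }
  assert (e * e * dot d q q <= e * e * Q) by (apply Rmult_le_compat_l; nra).
  assert (e * gap <= e * dot d f q) by (apply Rmult_le_compat_l; lra).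
  assert (e * (e * (1 + Q)) <= e * gap) by (apply Rmult_le_compat_l; lra).
  assert (0 < e * gap) by now apply Rmult_lt_0_compat.
  nra.
Qed.

(** * Decay of the projected system *)

(** Trajectories are extended by their initial value to negative times, since the comparison lemmas
    ask for continuity on R. *)
Lemma cont_on_nonneg_clamp g : cont_on_nonneg g -> continuity (fun t => g (Rmax 0 t)).
Proof.
  intros Hg t eps Heps. destruct (Hg (Rmax 0 t) (Rmax_l 0 t) eps Heps) as (delta & Hd & H).
  exists delta. split; [exact Hd|]. intros s [_ Hs]. simpl in *. unfold Rdist in *.
  apply H; [apply Rmax_l|]. apply Rle_lt_trans with (2 := Hs).
  unfold Rmax. repeat destruct (Rle_dec _ _); unfold Rabs; repeat destruct (Rcase_abs _); lra.
Qed.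

Lemma derivable_clamp g t v : 0 < t -> derivable_pt_lim g t v ->
  derivable_pt_lim (fun s => g (Rmax 0 s)) t v.
Proof.
  intros Ht Hg. apply is_derive_Reals. apply is_derive_Reals in Hg.
  apply (is_derive_ext_loc g); [|exact Hg].
  apply filter_imp with (fun s => 0 < s); [|apply (open_gt 0 t), Ht].
  intros s Hs. now rewrite Rmax_right by lra.
Qed.

Lemma partition_finite e T : partition_seq e ->
  exists l, forall t, 0 < t < T -> ~ In t l -> exists m, e m < t < e (S m).
Proof.
  intros (H0 & _ & Hub). destruct (Hub T) as [N HN].
  exists (map e (seq 0 (S N))). intros t Ht Hl.
  destruct (sequence_gap e t N) as (i & _ & Hi).
  - lra.
  - intros i Hi ->. apply Hl, in_map, in_seq. lia.
  - now exists i.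
Qed.

(* [g] and [ly] are the follower and leader positions projected on a direction, [gd] and
   [lyd] their derivatives; [J] is a primitive of the majorant [Z] of the input [2 |z|]. *)
Definition scalar_system (n k : nat) (a_hi : R) (l : list R) (T : R)
  (al be : nat -> nat -> R -> R) (g gd ly lyd : nat -> R -> R) (J Z : R -> R) : Prop :=
  (forall i, (i < n)%nat -> continuity (g i)) /\
  (forall j, (j < k)%nat -> continuity (ly j)) /\ continuity J /\
  forall t, 0 < t < T -> ~ In t l ->
    (derivable_pt_lim J t (Z t) /\ 0 <= Z t) /\
    (forall j, (j < k)%nat -> derivable_pt_lim (ly j) t (lyd j t) /\
       Rabs (lyd j t) <= Z t / 2) /\
    (forall i, (i < n)%nat -> derivable_pt_lim (g i) t (gd i t) /\
       gd i t <= sumR n (fun j => al i j t * (g j t - g i t))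
                 + sumR k (fun j => be i j t * (ly j t - g i t)) + Z t / 2 /\
       (forall j, (j < n)%nat -> 0 <= al i j t <= a_hi) /\
       (forall j, (j < k)%nat -> 0 <= be i j t)).


(** [Z / 2] bounds both the leader speeds and the follower disturbances. Half of the growth of [J]
    is subtracted to form [h]; the other half pays for the drift of the leader [j0] that was highest
    at time [s]. The factor [c] is a parameter so that both full and incomplete windows are
    covered. *)
Lemma scalar_progress n k a_hi l T al be g gd ly lyd J Z s q c H :
  (1 <= k)%nat -> 0 <= a_hi ->
  scalar_system n k a_hi l T al be g gd ly lyd J Z ->
  0 <= s -> s <= q -> q <= T -> 0 <= H ->
  (forall h dh, cooperative n a_hi l s q al (fun i t => sumR k (fun j => be i j t)) h dh ->
     (forall i, (i < n)%nat -> h i s <= H) -> forall i, (i < n)%nat -> h i q <= c * H) ->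
  (exists j, (j < k)%nat /\ forall i, (i < n)%nat -> g i s <= ly j s + H) ->
  exists j, (j < k)%nat /\ forall i, (i < n)%nat -> g i q <= ly j q + (c * H + (J q - J s)).
Proof.
  intros Hk Ha (Hgc & Hlc & HJc & Hd) Hs Hsq HqT HH Hcontr (j1 & Hj1 & Hg1).
  destruct (argmax_exists k (fun j => ly j s) Hk) as (j0 & Hj0 & Hmax).
  set (M := ly j0 s) in *.
  assert (Hcst : forall v : R, continuity (fun _ => v))
    by (intros v; apply continuity_const; intros ? ?; reflexivity).
  assert (HJh : continuity (fun t => (J t - J s) * / 2)).
  { apply (continuity_mult (fun t => J t - J s) (fun _ => / 2)); [|apply Hcst].
    now apply continuity_minus. }
  assert (HJhd : forall t, 0 < t < T -> ~ In t l ->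
    derivable_pt_lim (fun t => (J t - J s) * / 2) t (Z t / 2)).
  { intros t Ht Hl. destruct (Hd t Ht Hl) as [[HJ _] _].
    apply is_derive_Reals. apply is_derive_Reals in HJ.
    evar_last.
    - apply (is_derive_scal_l (V := R_NormedModule) (fun t => J t - J s)).
      apply (is_derive_minus (V := R_NormedModule) J (fun _ => J s)); [exact HJ|].
      apply is_derive_const.
    - unfold scal, minus, plus, opp, zero; simpl; unfold mult; simpl. field. }
  assert (Hleader : forall j r, (j < k)%nat -> s <= r <= q ->
    ly j r - ((J r - J s) * / 2) <= ly j s /\ ly j s <= ly j r + (J r - J s) * / 2).
  { intros j r Hj Hr.
    assert (Hz : forall u, u - (J s - J s) * / 2 = u) by (intros; ring).
    assert (Hz' : forall u, u + (J s - J s) * / 2 = u) by (intros; ring).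
    split.
    - rewrite <- (Hz (ly j s)).
      apply (nonincreasing_off_finite l (fun t => ly j t - (J t - J s) * / 2)
        (fun t => lyd j t - Z t / 2)); [lra | now apply continuity_minus; auto |].
      intros t Ht Hl. destruct (Hd t ltac:(lra) Hl) as (_ & Hly & _).
      destruct (Hly j Hj) as [Hder Hb]. split.
      + apply derivable_pt_lim_minus; auto. apply HJhd; auto; lra.
      + assert (Hb' := Rle_abs (lyd j t)). lra.
    - apply Ropp_le_cancel. rewrite <- (Hz' (ly j s)).
      apply (nonincreasing_off_finite l (fun t => - (ly j t + (J t - J s) * / 2))
        (fun t => - (lyd j t + Z t / 2))); [lra | |].
      + apply (continuity_opp (fun t => ly j t + (J t - J s) * / 2)).
        apply continuity_plus; auto.
      + intros t Ht Hl. destruct (Hd t ltac:(lra) Hl) as (_ & Hly & _).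
        destruct (Hly j Hj) as [Hder Hb]. split.
        * apply (derivable_pt_lim_opp (fun t => ly j t + (J t - J s) * / 2)).
          apply derivable_pt_lim_plus; auto. apply HJhd; auto; lra.
        * assert (Hb' := Rle_abs (- lyd j t)). rewrite Rabs_Ropp in Hb'. lra. }
  set (h := fun i t => g i t - M - (J t - J s) * / 2).
  set (dh := fun i t => gd i t - 0 - Z t / 2).
  assert (Hco : cooperative n a_hi l s q al (fun i t => sumR k (fun j => be i j t)) h dh).
  { split.
    - intros i Hi. unfold h. apply (continuity_minus (fun t => g i t - M)); auto.
      apply continuity_minus; auto.
    - intros t Ht Hl i Hi. destruct (Hd t ltac:(lra) Hl) as (_ & _ & Hg).
      destruct (Hg i Hi) as (Hder & Hle & Hal & Hbe). split; [|split; [|split]].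
      + unfold h, dh. apply (derivable_pt_lim_minus (fun t => g i t - M)).
        * apply (derivable_pt_lim_minus (g i) (fun _ => M)); auto.
          apply derivable_pt_lim_const.
        * apply HJhd; auto; lra.
      + assert (Ha1 : sumR n (fun j => al i j t * (h j t - h i t)) =
          sumR n (fun j => al i j t * (g j t - g i t)))
          by (apply sumR_ext; intros; unfold h; ring).
        (* No leader has risen above [M + (J t - J s) / 2], so each difference [ly_j - g_i] is at
           most [- h_i]. *)
        assert (Hb1 : sumR k (fun j => be i j t * (ly j t - g i t)) <=
          sumR k (fun j => - h i t * be i j t)).
        { apply sumR_le. intros j Hj.
          destruct (Hleader j t Hj ltac:(lra)) as [Hlj _]. specialize (Hmax j Hj).
          simpl in Hmax. fold M in Hmax.
          rewrite (Rmult_comm (- h i t)). apply Rmult_le_compat_l; [auto|]. unfold h. lra. }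
        rewrite sumR_scal in Hb1. rewrite Ha1. unfold dh. lra.
      + exact Hal.
      + now apply sumR_nonneg. }
  exists j0. split; [exact Hj0|]. intros i Hi.
  assert (Hi0 : forall i, (i < n)%nat -> h i s <= H).
  { intros m Hm. unfold h. specialize (Hg1 m Hm). specialize (Hmax j1 Hj1).
    simpl in Hmax. fold M in Hmax. lra. }
  assert (Hq := Hcontr h dh Hco Hi0 i Hi). unfold h in Hq.
  destruct (Hleader j0 q Hj0 ltac:(lra)) as [_ HM]. fold M in HM. lra.
Qed.

Lemma scalar_primitive_monotone n k a_hi l T al be g gd ly lyd J Z s q :
  scalar_system n k a_hi l T al be g gd ly lyd J Z ->
  0 <= s -> s <= q -> q <= T -> J s <= J q.
Proof.
  intros (_ & _ & HJc & Hd) Hs Hsq HqT. apply Ropp_le_cancel.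
  apply (nonincreasing_off_finite l (fun t => - J t) (fun t => - Z t)); auto.
  - now apply continuity_opp.
  - intros t Ht Hl. destruct (Hd t ltac:(lra) Hl) as [[HJ HZ] _].
    split; [now apply derivable_pt_lim_opp | lra].
Qed.

(** Induction over the [m] complete windows of length [tau] in [[0, T]]; the input gathered so far
    is also multiplied by [c <= 1], so it is bounded by [J] itself. *)
Lemma scalar_decay n k a_hi l T al be g gd ly lyd J Z tau c H :
  (1 <= k)%nat -> 0 <= a_hi -> 0 < tau -> 0 <= c <= 1 -> 0 <= H -> 0 <= T ->
  scalar_system n k a_hi l T al be g gd ly lyd J Z -> J 0 = 0 ->
  (forall s h dh H, 0 <= s -> s + tau <= T -> 0 <= H ->
     cooperative n a_hi l s (s + tau) al (fun i t => sumR k (fun j => be i j t)) h dh ->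
     (forall i, (i < n)%nat -> h i s <= H) ->
     forall i, (i < n)%nat -> h i (s + tau) <= c * H) ->
  (exists j, (j < k)%nat /\ forall i, (i < n)%nat -> g i 0 <= ly j 0 + H) ->
  exists m, T < INR (S m) * tau /\
    exists j, (j < k)%nat /\ forall i, (i < n)%nat -> g i T <= ly j T + (c ^ m * H + J T).
Proof.
  intros Hk Ha Htau Hc HH HT Hsys HJ0 Hcontr Hinit.
  assert (Hiter : forall m, INR m * tau <= T -> exists j, (j < k)%nat /\
    forall i, (i < n)%nat ->
      g i (INR m * tau) <= ly j (INR m * tau) + (c ^ m * H + J (INR m * tau))).
  { induction m as [|m IH]; intros Hm.
    - simpl. rewrite Rmult_0_l, HJ0. destruct Hinit as (j & Hj & Hi).
      exists j. split; [auto|]. intros i Hin. specialize (Hi i Hin). lra.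
    - rewrite S_INR in Hm. assert (Hm0 := pos_INR m).
      assert (HmT : 0 <= INR m * tau) by (apply Rmult_le_pos; lra).
      assert (HJm : 0 <= J (INR m * tau)).
      { rewrite <- HJ0.
        apply (scalar_primitive_monotone n k a_hi l T al be g gd ly lyd J Z); auto; lra. }
      assert (Hcm : 0 <= c ^ m * H) by (apply Rmult_le_pos; [apply pow_le; lra | auto]).
      assert (Heq : INR (S m) * tau = INR m * tau + tau) by (rewrite S_INR; ring).
      destruct (scalar_progress n k a_hi l T al be g gd ly lyd J Z (INR m * tau)
        (INR (S m) * tau) c (c ^ m * H + J (INR m * tau))) as (j & Hj & Hi);
        auto; try (rewrite Heq; lra); try lra.
      + intros h dh. rewrite Heq. apply Hcontr; lra.
      + apply IH. lra.
      + exists j. split; [auto|]. intros i Hin. specialize (Hi i Hin).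
        assert (c * J (INR m * tau) <= 1 * J (INR m * tau))
          by (apply Rmult_le_compat_r; lra).
        simpl pow. lra. }
  destruct (dwell_cover (fun m => INR m * tau) tau Htau) with (s := T) as [m Hm]; auto.
  - simpl; ring.
  - intros m. rewrite S_INR. lra.
  - exists m. split; [lra|].
    assert (Hm0 : 0 <= INR m * tau) by (apply Rmult_le_pos; [apply pos_INR | lra]).
    assert (HJm : 0 <= J (INR m * tau)).
    { rewrite <- HJ0.
      apply (scalar_primitive_monotone n k a_hi l T al be g gd ly lyd J Z); auto; lra. }
    assert (Hcm : 0 <= c ^ m * H) by (apply Rmult_le_pos; [apply pow_le; lra | auto]).
    (* The incomplete last window does not contract; the maximum principle gives factor 1. *)
    destruct (scalar_progress n k a_hi l T al be g gd ly lyd J Z (INR m * tau)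
      T 1 (c ^ m * H + J (INR m * tau))) as (j & Hj & Hi); auto; try lra.
    + intros h dh Hco Hh i Hi. rewrite Rmult_1_l.
      apply (max_principle n a_hi l (INR m * tau) T al (fun i t => sumR k (fun j => be i j t)) h dh);
        auto; lra.
    + apply Hiter. lra.
    + exists j. split; [auto|]. intros i Hin. specialize (Hi i Hin). lra.
Qed.

(** * Comparison functions of classes K and KL *)

Lemma pow_le_exp theta m : 0 <= theta <= 1 -> (1 - theta) ^ m <= exp (- (theta * INR m)).
Proof.
  intros Hth. induction m as [|m IH].
  - simpl. rewrite Rmult_0_r, Ropp_0, exp_0. lra.
  - rewrite S_INR. replace (- (theta * (INR m + 1))) with (- theta + - (theta * INR m)) by ring.
    rewrite exp_plus. simpl. apply Rmult_le_compat; auto; [lra|apply pow_le; lra|].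
    apply Rle_trans with (1 + - theta); [lra | apply exp_ineq1_le].
Qed.

Lemma classKL_exp c lambda : 0 < lambda -> classKL (fun r s => r * exp (c - lambda * s)).
Proof.
  intros Hl. split; [|split].
  - intros r s _ _ eps Heps.
    assert (Hc : continuity_2d_pt (fun r s => r * exp (c - lambda * s)) r s).
    { apply continuity_2d_pt_mult; [apply continuity_2d_pt_id1|].
      apply (continuity_1d_2d_pt_comp (fun s => exp (c - lambda * s)) (fun _ s => s)).
      - apply derivable_continuous_pt. reg.
      - apply continuity_2d_pt_id2. }
    destruct (Hc (mkposreal eps Heps)) as [delta H]. exists delta.
    split; [apply cond_pos|]. intros r' s' _ _ Hr Hs. now apply H.
  - intros s Hs. split; [ring|split].
    + intros r Hr eps Heps. assert (He := exp_pos (c - lambda * s)).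
      exists (eps / exp (c - lambda * s)). split; [now apply Rdiv_lt_0_compat|].
      intros r' _ Hr'. rewrite <- Rmult_minus_distr_r, Rabs_mult.
      rewrite (Rabs_right (exp _)) by lra.
      apply (Rmult_lt_compat_r (exp (c - lambda * s))) in Hr'; auto.
      unfold Rdiv in Hr'. rewrite Rmult_assoc, Rinv_l in Hr' by lra. lra.
    + intros r r' _ Hr. apply Rmult_lt_compat_r; [apply exp_pos|auto].
  - intros r Hr. split.
    + intros s1 s2 Hs1 Hs. apply Rmult_le_compat_l; [auto|].
      replace (c - lambda * s2) with (c + - (lambda * s2)) by ring.
      replace (c - lambda * s1) with (c + - (lambda * s1)) by ring.
      rewrite !exp_plus. apply Rmult_le_compat_l; [left; apply exp_pos|].
      apply exp_opp_le; lra.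
    + intros eps Heps. exists ((c + r / eps) / lambda).
      intros s Hs.
      assert (Hre : 0 <= r / eps) by (apply Rdiv_le_0_compat; lra).
      assert (He := exp_pos (c - lambda * s)).
      rewrite Rabs_right by (apply Rle_ge, Rmult_le_pos; lra).
      assert (Hs' : c + r / eps <= lambda * s).
      { apply (Rmult_le_compat_l lambda) in Hs; [|lra].
        replace (lambda * ((c + r / eps) / lambda)) with (c + r / eps) in Hs by (field; lra).
        exact Hs. }
      (* [exp (c - lambda s) <= exp (- r / eps)] and [(1 + r / eps) exp (- r / eps) <= 1] *)
      assert (Hexp : (1 + r / eps) * exp (c - lambda * s) <= 1).
      { apply Rle_trans with (exp (r / eps) * exp (c - lambda * s)).
        - apply Rmult_le_compat_r; [lra | apply exp_ineq1_le].
        - rewrite <- exp_plus. apply exp_le_1. lra. }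
      assert (Hr' : r = r / eps * eps) by (field; lra).
      rewrite Hr' at 1. set (v := r / eps) in *. nra.
Qed.

Lemma classK_double : classK (fun r => 2 * r).
Proof.
  split; [ring|split; [|intros; lra]].
  intros t _ eps Heps. exists (eps / 2). split; [lra|]. intros s _ Hs.
  rewrite <- Rmult_minus_distr_l, Rabs_mult, (Rabs_right 2) by lra. lra.
Qed.

(** * Projection of a solution on a direction *)

Lemma dot_add_r d u v w : dot d u (fun c => v c + w c) = dot d u v + dot d u w.
Proof. unfold dot. rewrite <- sumR_plus. apply sumR_ext. intros; ring. Qed.

Lemma dot_sum_r d m eta (f : nat -> vec) :
  dot d eta (fun c => sumR m (fun j => f j c)) = sumR m (fun j => dot d eta (f j)).
Proof.
  unfold dot. rewrite <- sumR_swap. apply sumR_ext. intros c _. now rewrite <- sumR_scal.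
Qed.

(** Moves the arc's switch into the coefficient, so that an inactive arc becomes a zero weight of
    the scalar system. *)
Lemma dot_gated_difference d eta (on : bool) r (v w : vec) :
  dot d eta (fun c => if on then r * (v c - w c) else 0) =
  (if on then r else 0) * (dot d eta v - dot d eta w).
Proof.
  rewrite <- dot_sub_r. unfold dot. rewrite <- sumR_scal. apply sumR_ext.
  intros c _. destruct on; ring.
Qed.

Lemma dot_rhs d n k sigma a b w X Y t i eta :
  dot d eta (rhs_x n k sigma a b w X Y t i) =
  sumR n (fun j => (if sigma t (VF j) (VF i) then a i j X Y t else 0)
                   * (dot d eta (X j) - dot d eta (X i)))
  + sumR k (fun j => (if sigma t (VL j) (VF i) then b i j X Y t else 0)
                     * (dot d eta (Y j) - dot d eta (X i)))
  + dot d eta (w i t).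
Proof.
  unfold rhs_x. rewrite dot_add_r, dot_add_r, !dot_sum_r.
  f_equal; f_equal; apply sumR_ext; intros j _; apply dot_gated_difference.
Qed.

Lemma dot_continuity d eta (f : R -> vec) :
  (forall c, (c < d)%nat -> continuity (fun t => f t c)) ->
  continuity (fun t => dot d eta (f t)).
Proof.
  intros H. apply (sumR_continuity d (fun c t => eta c * f t c)). intros c Hc.
  apply (continuity_scal (fun t => f t c)), H, Hc.
Qed.

Lemma dot_derivable d eta (f : R -> vec) (v : vec) t :
  (forall c, (c < d)%nat -> derivable_pt_lim (fun s => f s c) t (v c)) ->
  derivable_pt_lim (fun s => dot d eta (f s)) t (dot d eta v).
Proof.
  intros H. apply (sumR_derivable d (fun c s => eta c * f s c) (fun c _ => eta c * v c)).
  intros c Hc. apply (derivable_pt_lim_scal (fun s => f s c)), H, Hc.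
Qed.

Lemma normd_leader_le n k d u w y t j : (j < k)%nat ->
  normd d (u j (y t) t) <= z_norm n k d u w y t.
Proof.
  intros Hj. apply sqrt_le_1_alt.
  assert (H : sumR d (fun c => u j (y t) t c ^ 2) <=
    sumR k (fun j => sumR d (fun c => u j (y t) t c ^ 2))).
  { apply (sumR_term_le k (fun j => sumR d (fun c => u j (y t) t c ^ 2))); auto.
    intros; apply sumR_nonneg; intros; apply pow2_ge_0. }
  assert (0 <= sumR n (fun i => sumR d (fun c => w i t c ^ 2))).
  { apply sumR_nonneg; intros; apply sumR_nonneg; intros; apply pow2_ge_0. }
  lra.
Qed.

Lemma normd_follower_le n k d u w y t i : (i < n)%nat ->
  normd d (w i t) <= z_norm n k d u w y t.
Proof.
  intros Hi. apply sqrt_le_1_alt.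
  assert (H : sumR d (fun c => w i t c ^ 2) <=
    sumR n (fun i => sumR d (fun c => w i t c ^ 2))).
  { apply (sumR_term_le n (fun i => sumR d (fun c => w i t c ^ 2))); auto.
    intros; apply sumR_nonneg; intros; apply pow2_ge_0. }
  assert (0 <= sumR k (fun j => sumR d (fun c => u j (y t) t c ^ 2))).
  { apply sumR_nonneg; intros; apply sumR_nonneg; intros; apply pow2_ge_0. }
  lra.
Qed.

(** A unit [eta] does not increase norms, so the projected inputs are at most [|z| <= Z / 2]. The
    exceptional times are those of the majorant together with the breakpoints of the solution before
    [T]. *)
Lemma projected_system n k d sigma a b a_lo a_hi b_lo u w x y eta T J Z l :
  0 < a_lo -> a_lo <= a_hi -> 0 < b_lo ->
  (forall i j X Y t, (i < n)%nat -> (j < n)%nat -> 0 <= t -> a_lo <= a i j X Y t <= a_hi) ->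
  (forall i j X Y t, (i < n)%nat -> (j < k)%nat -> 0 <= t -> b_lo <= b i j X Y t) ->
  is_solution n k d sigma a b u w x y ->
  dot d eta eta = 1 -> continuity J ->
  (forall t, 0 < t < T -> ~ In t l ->
    derivable_pt_lim J t (Z t) /\ 2 * z_norm n k d u w y t <= Z t) ->
  exists l', scalar_system n k a_hi l' T
    (fun i j t => if sigma t (VF j) (VF i) then a i j (x t) (y t) t else 0)
    (fun i j t => if sigma t (VL j) (VF i) then b i j (x t) (y t) t else 0)
    (fun i t => dot d eta (x (Rmax 0 t) i))
    (fun i t => dot d eta (rhs_x n k sigma a b w (x t) (y t) t i))
    (fun j t => dot d eta (y (Rmax 0 t) j))
    (fun j t => dot d eta (u j (y t) t)) J Z.
Proof.
  intros Ha Hah Hb Hab Hbb (Hxc & Hyc & e & He & Hsol) Heta HJc HJ.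
  destruct (partition_finite e T He) as [l2 Hl2].
  exists (l ++ l2). split; [|split; [|split; [exact HJc|]]].
  - intros i Hi. apply dot_continuity. intros c Hc.
    apply (cont_on_nonneg_clamp (fun t => x t i c)), Hxc; auto.
  - intros j Hj. apply dot_continuity. intros c Hc.
    apply (cont_on_nonneg_clamp (fun t => y t j c)), Hyc; auto.
  - intros t Ht Hl.
    destruct (HJ t Ht (fun H => Hl (in_or_app _ _ _ (or_introl H)))) as [HJt HZ].
    destruct (Hl2 t Ht (fun H => Hl (in_or_app _ _ _ (or_intror H)))) as [m Hm].
    destruct (Hsol m t Hm) as [Hxd Hyd].
    assert (Hz0 : 0 <= z_norm n k d u w y t) by apply sqrt_pos.
    split; [split; [exact HJt | lra] | split].
    + intros j Hj. split.
      * apply (dot_derivable d eta (fun s => y (Rmax 0 s) j)). intros c Hc.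
        apply (derivable_clamp (fun s => y s j c)); [lra|]. now apply Hyd.
      * assert (H1 := dot_unit_abs_le d eta (u j (y t) t) Heta).
        assert (H2 := normd_leader_le n k d u w y t j Hj). lra.
    + intros i Hi. split; [|split; [|split]].
      * apply (dot_derivable d eta (fun s => x (Rmax 0 s) i)). intros c Hc.
        apply (derivable_clamp (fun s => x s i c)); [lra|]. now apply Hxd.
      * rewrite dot_rhs, !Rmax_right by lra.
        assert (H1 := dot_unit_le d eta (w i t) Heta).
        assert (H2 := normd_follower_le n k d u w y t i Hi). lra.
      * intros j Hj. specialize (Hab i j (x t) (y t) t Hi Hj ltac:(lra)).
        destruct (sigma t (VF j) (VF i)); lra.
      * intros j Hj. specialize (Hbb i j (x t) (y t) t Hi Hj ltac:(lra)).
        destruct (sigma t (VL j) (VF i)); lra.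
Qed.

(** * Uniform constants and the SiISS estimate *)

Theorem theorem2
  (n k d : nat) (Hn : (2 <= n)%nat) (Hk : (1 <= k)%nat) (Hd : (1 <= d)%nat)
  (sigma : R -> digraph) (Hsigma : admissible_switching n k sigma)
  (a b : nat -> nat -> stack -> stack -> R -> R)
  (a_lo a_hi b_lo : R) (Ha_lo : 0 < a_lo) (Ha_lohi : a_lo <= a_hi) (Hb_lo : 0 < b_lo)
  (Ha_cont : forall i j, (i < n)%nat -> (j < n)%nat -> cont_xyt n k d (a i j))
  (Hb_cont : forall i j, (i < n)%nat -> (j < k)%nat -> cont_xyt n k d (b i j))
  (Ha_bnd : forall i j X Y t, (i < n)%nat -> (j < n)%nat -> 0 <= t ->
              a_lo <= a i j X Y t <= a_hi)
  (Hb_bnd : forall i j X Y t, (i < n)%nat -> (j < k)%nat -> 0 <= t ->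
              b_lo <= b i j X Y t)
  (HUJLC : UJLC n k sigma) :
  exists (beta : R -> R -> R) (gamma : R -> R),
    classKL beta /\ classK gamma /\
    forall (u : nat -> stack -> R -> vec) (w : nat -> R -> vec),
      (forall j c, (j < k)%nat -> (c < d)%nat ->
         (forall t, 0 <= t -> cont_y k d (fun Y => u j Y t c)) /\
         (forall Y, piecewise_cont (fun t => u j Y t c))) ->
      (forall i c, (i < n)%nat -> (c < d)%nat -> cont_on_nonneg (fun t => w i t c)) ->
      forall x y : R -> stack,
        is_solution n k d sigma a b u w x y ->
        forall t (Ht : 0 <= t)
          (pr : Riemann_integrable (fun s => gamma (z_norm n k d u w y s)) 0 t),
          state_dist n k d (x t) (y t)
            <= beta (state_dist n k d (x 0) (y 0)) t + RiemannInt pr.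
Proof.
  destruct HUJLC as (T & HT & HL).
  destruct (arc_dwell n k sigma Hsigma) as (delta & Hdel & Hdw).
  set (mu := Rmin a_lo b_lo). assert (Hmu : 0 < mu) by now apply Rmin_pos.
  assert (Ha0 : 0 <= a_hi) by lra.
  assert (HA : 0 <= INR n * a_hi) by (apply Rmult_le_pos; [apply pos_INR | lra]).
  assert (HAd : 0 < (INR n * a_hi + mu) * delta) by (apply Rmult_lt_0_compat; lra).
  (* The solution of the equation in [gap_gain] for an arc active during [delta]. *)
  set (kappa := mu / (1 + (INR n * a_hi + mu) * delta)).
  assert (Hkap : kappa * (1 + (INR n * a_hi + mu) * delta) = mu)
    by (unfold kappa; field; lra).
  assert (Hk0 : 0 < kappa) by (apply Rdiv_lt_0_compat; lra).
  set (E := exp (- (INR n * a_hi * (T + 2 * delta)))).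
  assert (HE : 0 < E <= 1).
  { split; [apply exp_pos|]. apply exp_le_1.
    assert (0 <= INR n * a_hi * (T + 2 * delta)) by (apply Rmult_le_pos; lra). lra. }
  (* The share of [H] lost over [n] windows; it depends only on the topology and the weight bounds,
     so [beta] is uniform in inputs and initial states. *)
  set (theta := (kappa * delta * E ^ 2) ^ n).
  assert (Htheta : 0 < theta <= 1).
  { assert (Hkd : 0 < kappa * delta <= 1).
    { split; [now apply Rmult_lt_0_compat|].
      assert (0 <= INR n * a_hi * (kappa * delta)) by (apply Rmult_le_pos; nra). nra. }
    assert (0 < E ^ 2 <= 1) by nra.
    assert (0 < kappa * delta * E ^ 2 <= 1) by (split; [apply Rmult_lt_0_compat; lra | nra]).
    unfold theta. split; [apply pow_lt; lra|]. rewrite <- (pow1 n). apply pow_incr; lra. }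
  set (tau := INR n * (T + 2 * delta)).
  assert (Htau : 0 < tau).
  { apply Rmult_lt_0_compat; [apply lt_0_INR; lia | lra]. }
  (* With [m > s / tau - 1] complete windows, [(1 - theta)^m <= exp (- theta m) <= exp (theta -
     theta s / tau)]. The 2 in [gamma] counts the leader drift and the follower disturbance. *)
  exists (fun r s => r * exp (theta - theta / tau * s)), (fun r => 2 * r).
  split; [apply classKL_exp, Rdiv_lt_0_compat; lra | split; [apply classK_double|]].
  intros u w _ _ x y Hsol t Ht pr.
  set (D0 := state_dist n k d (x 0) (y 0)).
  assert (HD0 : 0 <= D0) by apply maxR_nonneg.
  apply le_epsilon. intros eps Heps.
  destruct (integrable_majorant_primitive _ t pr eps Ht Heps)
    as (J & Z & l & HJc & HJ0 & HJt & HJd).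
  assert (HJpos : 0 <= J t).
  { rewrite <- HJ0. apply Ropp_le_cancel.
    apply (nonincreasing_off_finite l (fun s => - J s) (fun s => - Z s)); auto.
    - now apply continuity_opp.
    - intros s Hs Hl. destruct (HJd s Hs Hl) as [HJs HZ].
      assert (0 <= z_norm n k d u w y s) by apply sqrt_pos.
      split; [now apply derivable_pt_lim_opp | lra]. }
  assert (Hexp := exp_pos (theta - theta / tau * t)).
  assert (HB : 0 <= D0 * exp (theta - theta / tau * t)) by (apply Rmult_le_pos; lra).
  apply Rle_trans with (D0 * exp (theta - theta / tau * t) + J t); [|lra].
  apply maxR_le; [lra|]. intros i Hi.
  (* [J] and [Z] were chosen before [eta], so one majorant serves all directions. *)
  apply hull_dist_le_of_support; [auto | lra |]. intros eta Heta.
  destruct (projected_system n k d sigma a b a_lo a_hi b_lo u w x y eta t J Z l)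
    as (l' & Hsys); auto.
  destruct (scalar_decay n k a_hi l' t _ _ _ _ _ _ J Z tau (1 - theta) D0 Hk Ha0 Htau
    ltac:(lra) HD0 Ht Hsys HJ0) as (m & Hm & j & Hj & Hgi).
  - intros s h dh H Hs _ HH Hco Hh.
    apply (windows_contraction n k sigma a_hi mu delta T kappa l'
      (fun i j t => if sigma t (VF j) (VF i) then a i j (x t) (y t) t else 0)
      (fun i j t => if sigma t (VL j) (VF i) then b i j (x t) (y t) t else 0) h dh); auto.
    intros r p Hr Hp. repeat split.
    + intros j Hj ->. apply Rle_trans with a_lo; [apply Rmin_l | now apply Ha_bnd].
    + intros j Hj. assert (Hbp := Hb_bnd p j (x r) (y r) r Hp Hj Hr).
      destruct (sigma r (VL j) (VF p)); lra.
    + intros j Hj ->. apply Rle_trans with b_lo; [apply Rmin_r | now apply Hb_bnd].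
  (* At time 0 the highest leader in direction [eta] witnesses the initial bound with [H = D0]. *)
  - destruct (argmax_exists k (fun j => dot d eta (y 0 j)) Hk) as (j & Hj & Hmax).
    exists j. split; [exact Hj|]. intros p Hp. rewrite Rmax_right by lra.
    apply Rle_trans with (1 := support_le_hull_dist k d (y 0) (x 0 p) eta _ Hk Heta Hmax).
    apply Rplus_le_compat_l.
    apply (maxR_ge n (fun i => hull_dist k d (y 0) (x 0 i))), Hp.
  - exists j. split; [exact Hj|]. specialize (Hgi i Hi). rewrite Rmax_right in Hgi by lra.
    apply Rle_trans with (1 := Hgi). apply Rplus_le_compat_l, Rplus_le_compat_r.
    rewrite Rmult_comm. apply Rmult_le_compat_l; [auto|].
    apply Rle_trans with (1 := pow_le_exp theta m ltac:(lra)).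
    (* Converts the window count into elapsed time: [t < (m + 1) tau]; the extra window is the
       constant [theta] in the exponent of [beta]. *)
    assert (Hmt : theta / tau * t <= theta / tau * (INR (S m) * tau)).
    { apply Rmult_le_compat_l; [left; apply Rdiv_lt_0_compat; lra | lra]. }
    replace (theta / tau * (INR (S m) * tau)) with (theta * INR m + theta) in Hmt
      by (rewrite S_INR; field; lra).
    destruct (Rle_lt_or_eq_dec (- (theta * INR m)) (theta - theta / tau * t))
      as [Hlt|Heq]; [lra | left; now apply exp_increasing | rewrite Heq; lra].
Qed.
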